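(* Let $X$ be a connected, Hausdorff, semilocally $1$-connected space, and let $x \in X$. Let $Q^2X$ be the symmetric square of $X$, and let $\langle x\rangle$ denote the class in $Q^2X$ of $(x,x)$. Then the fundamental group $\pi(Q^2X,\langle x\rangle)$ is isomorphic to $\pi(X,x)^{\mathrm{ab}}$, the abelianisation of the fundamental group of $X$ at $x$.
   Context: For a space $X$, let $\mathbb{Z}_2=\{1,g\}$ act on $X\times X$ by interchanging factors, $g\cdot(x,y)=(y,x)$. The symmetric square $Q^2X$ is the orbit space $(X\times X)/\mathbb{Z}_2$ with the identification (quotient) topology. $\pi(X,x)$ denotes the fundamental group of $X$ based at $x$. Semilocally $1$-connected means semi-locally simply connected: each point $x$ has a neighbourhood $U$ such that every loop in $U$ at $x$ is null-homotopic (rel end points) in $X$. *)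

(* Defs.v *)
From HB Require Import structures.
From mathcomp Require Import all_boot all_order all_algebra.
From mathcomp Require Import all_classical all_reals topology normedtype.
From mathcomp Require Import continuous_path.
From mathcomp Require Import lra.

Set Implicit Arguments.
Unset Strict Implicit.
Unset Printing Implicit Defensive.

Import Order.TTheory GRing.Theory Num.Theory.
Import numFieldNormedType.Exports.

Local Open Scope classical_set_scope.
Local Open Scope ring_scope.
Local Open Scope quotient_scope.

Section UnitInterval.
Variable R : realType.

Definition unit_interval : Type := set_type (`[0, 1]%classic : set R).

HB.instance Definition _ := Topological.on unit_interval.

Definition of_unit (t : unit_interval) : R := set_val t.

Lemma clamp_subproof (r : R) :
  Num.max 0 (Num.min r 1) \in (`[0, 1]%classic : set R).
Proof.
rewrite inE /= in_itv /=; apply/andP; split; first by rewrite le_max lexx.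
by rewrite ge_max ler01 ge_min lexx orbT.
Qed.

(* The retraction of R onto [0, 1]; [concat] and [reverse] only apply it to
   reals already in [0, 1], where it is the inverse of [of_unit]. *)
Definition clamp (r : R) : unit_interval :=
  @exist R (fun s => s \in (`[0, 1]%classic : set R)) _ (clamp_subproof r).

Lemma of_unit_itv t : 0 <= of_unit t <= 1.
Proof. by rewrite /of_unit set_valE; case: t => t /=; rewrite inE /= in_itv. Qed.

Lemma of_unit_inj : injective of_unit.
Proof. by move=> s t; rewrite /of_unit set_valE; exact: val_inj. Qed.

Lemma clampK (r : R) : 0 <= r <= 1 -> of_unit (clamp r) = r.
Proof.
by case/andP=> r0 r1; rewrite /of_unit set_valE /= (min_l r1) max_r.
Qed.

Lemma of_unitK : cancel of_unit clamp.
Proof. by move=> t; apply: of_unit_inj; rewrite clampK // of_unit_itv. Qed.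

Lemma unit_zero_neq_one : clamp 0 != clamp 1.
Proof.
apply/eqP => /(congr1 of_unit).
by rewrite !clampK ?lexx ?ler01 // => /eqP; rewrite eq_sym oner_eq0.
Qed.

HB.instance Definition _ := @isBiPointed.Build unit_interval
  (clamp 0) (clamp 1) unit_zero_neq_one.

Lemma of_unit0 : of_unit zero = 0.
Proof. by rewrite clampK // lexx ler01. Qed.

Lemma of_unit1 : of_unit one = 1.
Proof. by rewrite clampK // lexx ler01. Qed.

Lemma continuous_of_unit : continuous of_unit.
Proof. exact: initial_continuous. Qed.

Lemma continuous_clamp : continuous clamp.
Proof.
apply: (@continuous_comp_initial _ _ _ (@set_val _ _) clamp).
rewrite (_ : _ \o _ = cst 0 \max (idfun \min cst 1)); last first.
  by apply/funext => r; rewrite /= set_valE.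
move=> r; apply: continuous_max; first exact: cst_continuous.
by apply: continuous_min; [exact: cvg_id | exact: cst_continuous].
Qed.

Lemma continuous_clamp_comp (T : topologicalType) (f : T -> R) :
  continuous f -> continuous (clamp \o f).
Proof.
by move=> cf t; apply: continuous_comp; [exact: cf|exact: continuous_clamp].
Qed.

Lemma continuous_scale (T : topologicalType) (u : T -> R) (k : R) :
  continuous u -> continuous (fun t => k * u t).
Proof.
move=> cu t; apply: (@continuousM R T (cst k) u); last exact: cu.
exact: cst_continuous.
Qed.

Lemma continuous_affine (T : topologicalType) (u : T -> R) (k c : R) :
  continuous u -> continuous (fun t => k * u t + c).
Proof.
move=> cu t; apply: (@continuousD R R T (fun t => k * u t) (cst c)).
  exact: continuous_scale.
exact: cst_continuous.
Qed.

Lemma continuous_opp_unit : continuous (fun t => 1 - of_unit t).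
Proof.
rewrite (_ : (fun _ => _) = (fun t => -1 * of_unit t + 1)).
  by apply: continuous_affine; exact: continuous_of_unit.
by apply/funext => t; rewrite mulN1r addrC.
Qed.

Lemma continuous_left (T : topologicalType) (h : T -> unit_interval) :
  continuous h -> continuous (fun t => clamp (2 * of_unit (h t))).
Proof.
move=> ch; apply: continuous_clamp_comp; apply: continuous_scale => t.
by apply: (@continuous_comp _ _ _ h of_unit);
  [exact: ch|exact: continuous_of_unit].
Qed.

Lemma continuous_right (T : topologicalType) (h : T -> unit_interval) :
  continuous h -> continuous (fun t => clamp (2 * of_unit (h t) - 1)).
Proof.
move=> ch; apply: continuous_clamp_comp; apply: continuous_affine => t.
by apply: (@continuous_comp _ _ _ h of_unit);
  [exact: ch|exact: continuous_of_unit].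
Qed.

Lemma continuous_rev : continuous (fun t => clamp (1 - of_unit t)).
Proof. by apply: continuous_clamp_comp; exact: continuous_opp_unit. Qed.

Lemma continuous_unit_id : continuous (@id unit_interval).
Proof. by move=> t; exact: cvg_id. Qed.

End UnitInterval.

Section Glue.
Variables (R : realType) (T U : topologicalType).

Lemma continuous_glue (h : T -> R) (c : R) (f g : T -> U) :
  continuous h -> continuous f -> continuous g ->
  (forall t, h t = c -> f t = g t) ->
  continuous (fun t => if h t <= c then f t else g t).
Proof.
move=> ch cf cg fg; apply/continuous_closedP => W cW.
rewrite (_ : _ @^-1` W = (h @^-1` [set r | r <= c] `&` f @^-1` W) `|`
                        (h @^-1` [set r | c <= r] `&` g @^-1` W)).
  apply: closedU; apply: closedI.
  - by move/continuous_closedP: ch; apply; exact: closed_le.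
  - by move/continuous_closedP: cf; apply.
  - by move/continuous_closedP: ch; apply; exact: closed_ge.
  - by move/continuous_closedP: cg; apply.
apply/seteqP; split => t /=.
  by case: leP => [hc Wf|/ltW hc Wg]; [left|right].
case=> -[hc]; first by rewrite hc.
case: leP => // ch' Wg; rewrite fg //; apply/eqP.
by rewrite eq_le ch' hc.
Qed.

End Glue.

Section Homotopy.
Variables (R : realType) (X : topologicalType).
Local Notation I := (unit_interval R).
Implicit Types x y z : X.

Section Concat.
Variables (x y z : X) (p : {path I from x to y}) (q : {path I from y to z}).

Definition concat_fun (t : I) : X :=
  if of_unit t <= 2^-1 then p (clamp (2 * of_unit t))
  else q (clamp (2 * of_unit t - 1)).

Lemma concat_continuous : continuous concat_fun.
Proof.
apply: (continuous_glue (h := @of_unit R)).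
- exact: continuous_of_unit.
- move=> t; apply: (@continuous_comp _ _ _ (fun t => clamp (2 * of_unit t)) p);
    last exact: cts_fun.
  exact: (continuous_left (@continuous_unit_id R)).
- move=> t.
  apply: (@continuous_comp _ _ _ (fun t => clamp (2 * of_unit t - 1)) q);
    last exact: cts_fun.
  exact: (continuous_right (@continuous_unit_id R)).
- move=> t ->; rewrite mulfV ?pnatr_eq0 // subrr.
  by rewrite [LHS]path_one [RHS]path_zero.
Qed.

Lemma concat_zero : concat_fun zero = x.
Proof.
rewrite /concat_fun of_unit0 invr_ge0 ler0n mulr0.
exact: path_zero.
Qed.

Lemma concat_one : concat_fun one = z.
Proof.
rewrite /concat_fun of_unit1 ifF; last by apply/negbTE; rewrite -ltNge; lra.
by rewrite (_ : _ - 1 = 1) ?[LHS]path_one //; lra.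
Qed.

Definition concat : {path I from x to z} :=
  mk_path concat_continuous concat_zero concat_one.

End Concat.

Section Reverse.
Variables (x y : X) (p : {path I from x to y}).

Definition reverse_fun (t : I) : X := p (clamp (1 - of_unit t)).

Lemma reverse_continuous : continuous reverse_fun.
Proof.
move=> t; apply: (@continuous_comp _ _ _ (fun t => clamp (1 - of_unit t)) p);
  last exact: cts_fun.
exact: continuous_rev.
Qed.

Lemma reverse_zero : reverse_fun zero = y.
Proof. by rewrite /reverse_fun of_unit0 subr0 [LHS]path_one. Qed.

Lemma reverse_one : reverse_fun one = x.
Proof. by rewrite /reverse_fun of_unit1 subrr [LHS]path_zero. Qed.

Definition reverse : {path I from y to x} :=
  mk_path reverse_continuous reverse_zero reverse_one.

End Reverse.

Definition const_path x : {path I from x to x} := cst x.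

(* Homotopy relative to the end points; the second coordinate of [H] is the
   deformation parameter. *)
Definition path_homotopic x y (p q : {path I from x to y}) : Prop :=
  exists H : I * I -> X,
    [/\ continuous H,
        forall s, H (s, zero) = p s,
        forall s, H (s, one) = q s,
        forall t, H (zero, t) = x
      & forall t, H (one, t) = y].

Lemma continuous_fst_unit : continuous (fun st : I * I => of_unit st.1).
Proof.
move=> st; apply: (@continuous_comp _ _ _ fst (@of_unit R)).
  exact: cvg_fst.
exact: continuous_of_unit.
Qed.

Lemma continuous_snd_unit : continuous (fun st : I * I => of_unit st.2).
Proof.
move=> st; apply: (@continuous_comp _ _ _ snd (@of_unit R)).
  exact: cvg_snd.
exact: continuous_of_unit.
Qed.

Lemma continuous_pair_comp (T A B C : topologicalType) (H : A * B -> C)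
    (u : T -> A) (v : T -> B) :
  continuous H -> continuous u -> continuous v ->
  continuous (fun t => H (u t, v t)).
Proof.
move=> cH cu cv t; apply: (@continuous_comp _ _ _ (fun t => (u t, v t)) H);
  last exact: cH.
by apply: cvg_pair; [exact: cu|exact: cv].
Qed.

Lemma reparam_homotopic x y (f : I -> X) (u v : I -> R)
    (p q : {path I from x to y}) :
  continuous f -> continuous u -> continuous v ->
  u zero = v zero -> u one = v one ->
  (forall s, p s = f (clamp (u s))) -> (forall s, q s = f (clamp (v s))) ->
  path_homotopic p q.
Proof.
move=> cf cu cv uv0 uv1 pE qE.
exists (fun st => f (clamp ((1 - of_unit st.2) * u st.1 +
                            of_unit st.2 * v st.1))); split.
- move=> st; apply: (@continuous_comp _ _ _ (fun st : I * I => clamp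
    ((1 - of_unit st.2) * u st.1 + of_unit st.2 * v st.1)) f); last exact: cf.
  apply: continuous_clamp_comp => {}st.
  have c1 (w : I -> R) : continuous w ->
      {for st, continuous (fun st : I * I => w st.1)}.
    move=> cw; apply: (@continuous_comp _ _ _ fst w); last exact: cw.
    exact: cvg_fst.
  have c2 (w : I -> R) : continuous w ->
      {for st, continuous (fun st : I * I => w st.2)}.
    move=> cw; apply: (@continuous_comp _ _ _ snd w); last exact: cw.
    exact: cvg_snd.
  apply: (@continuousD R R _
    (fun st : I * I => (1 - of_unit st.2) * u st.1)
    (fun st : I * I => of_unit st.2 * v st.1)).
    apply: (@continuousM R _ (fun st : I * I => 1 - of_unit st.2)
      (fun st : I * I => u st.1)); last exact: c1.
    exact: (c2 _ (@continuous_opp_unit R)).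
  apply: (@continuousM R _ (fun st : I * I => of_unit st.2)
    (fun st : I * I => v st.1)); last exact: c1.
  exact: (c2 _ (@continuous_of_unit R)).
- by move=> s /=; rewrite of_unit0 subr0 mul1r mul0r addr0 -pE.
- by move=> s /=; rewrite of_unit1 subrr mul0r mul1r add0r -qE.
- move=> t /=; rewrite -uv0 -mulrDl subrK mul1r -pE.
  exact: path_zero.
- move=> t /=; rewrite -uv1 -mulrDl subrK mul1r -pE.
  exact: path_one.
Qed.

Lemma path_homotopic_refl x y (p : {path I from x to y}) : path_homotopic p p.
Proof.
apply: (@reparam_homotopic _ _ p (@of_unit R) (@of_unit R)) => //.
- exact: cts_fun.
- exact: continuous_of_unit.
- exact: continuous_of_unit.
- by move=> s; rewrite of_unitK.
- by move=> s; rewrite of_unitK.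
Qed.

Lemma path_homotopic_sym x y (p q : {path I from x to y}) :
  path_homotopic p q -> path_homotopic q p.
Proof.
case=> H [cH H0 H1 Hx Hy].
exists (fun st => H (st.1, clamp (1 - of_unit st.2))); split => //=.
- apply: continuous_pair_comp => // st; first exact: cvg_fst.
  apply: (@continuous_comp _ _ _ snd (fun t : I => clamp (1 - of_unit t))).
    exact: cvg_snd.
  exact: continuous_rev.
- by move=> s; rewrite of_unit0 subr0 H1.
- by move=> s; rewrite of_unit1 subrr H0.
Qed.

Lemma continuous_fstI : continuous (fst : I * I -> I).
Proof. by move=> st; exact: cvg_fst. Qed.

Lemma continuous_sndI : continuous (snd : I * I -> I).
Proof. by move=> st; exact: cvg_snd. Qed.

Lemma path_homotopic_trans x y (p q r : {path I from x to y}) :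
  path_homotopic p q -> path_homotopic q r -> path_homotopic p r.
Proof.
case=> H [cH H0 H1 Hx Hy] [K [cK K0 K1 Kx Ky]].
exists (fun st => if of_unit st.2 <= 2^-1
                  then H (st.1, clamp (2 * of_unit st.2))
                  else K (st.1, clamp (2 * of_unit st.2 - 1))); split => /=.
- apply: continuous_glue; first exact: continuous_snd_unit.
  + apply: continuous_pair_comp => //; first exact: continuous_fstI.
    by apply: continuous_left; exact: continuous_sndI.
  + apply: continuous_pair_comp => //; first exact: continuous_fstI.
    by apply: continuous_right; exact: continuous_sndI.
  + move=> st ->; rewrite mulfV ?pnatr_eq0 // subrr.
    by rewrite [LHS]H1 [RHS]K0.
- by move=> s; rewrite of_unit0 invr_ge0 ler0n mulr0 [LHS]H0.
- move=> s; rewrite of_unit1 ifF; last by apply/negbTE; rewrite -ltNge; lra.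
  by rewrite (_ : _ - 1 = 1) ?[LHS]K1 //; lra.
- by move=> t; rewrite Hx Kx if_same.
- by move=> t; rewrite Hy Ky if_same.
Qed.

Lemma concat_homotopic x y z (p p' : {path I from x to y})
    (q q' : {path I from y to z}) :
  path_homotopic p p' -> path_homotopic q q' ->
  path_homotopic (concat p q) (concat p' q').
Proof.
case=> H [cH H0 H1 Hx Hy] [K [cK K0 K1 Kx Ky]].
exists (fun st => if of_unit st.1 <= 2^-1
                  then H (clamp (2 * of_unit st.1), st.2)
                  else K (clamp (2 * of_unit st.1 - 1), st.2)); split => /=.
- apply: continuous_glue; first exact: continuous_fst_unit.
  + apply: continuous_pair_comp => //; last exact: continuous_sndI.
    by apply: continuous_left; exact: continuous_fstI.
  + apply: continuous_pair_comp => //; last exact: continuous_sndI.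
    by apply: continuous_right; exact: continuous_fstI.
  + move=> st ->; rewrite mulfV ?pnatr_eq0 // subrr.
    by rewrite [LHS]Hy [RHS]Kx.
- by move=> s; rewrite H0 K0.
- by move=> s; rewrite H1 K1.
- by move=> t; rewrite of_unit0 invr_ge0 ler0n mulr0 [LHS]Hx.
- move=> t; rewrite of_unit1 ifF; last by apply/negbTE; rewrite -ltNge; lra.
  by rewrite (_ : _ - 1 = 1) ?[LHS]Ky //; lra.
Qed.

Lemma reverse_homotopic x y (p p' : {path I from x to y}) :
  path_homotopic p p' -> path_homotopic (reverse p) (reverse p').
Proof.
case=> H [cH H0 H1 Hx Hy].
exists (fun st => H (clamp (1 - of_unit st.1), st.2)); split => /=.
- apply: continuous_pair_comp => // st; last exact: cvg_snd.
  apply: (@continuous_comp _ _ _ fst (fun t : I => clamp (1 - of_unit t))).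
    exact: cvg_fst.
  exact: continuous_rev.
- by move=> s; rewrite H0.
- by move=> s; rewrite H1.
- by move=> t; rewrite of_unit0 subr0 Hy.
- by move=> t; rewrite of_unit1 subrr Hx.
Qed.

Let ct (k c : R) : continuous (fun s : I => k * of_unit s + c).
Proof.
by apply: continuous_affine; exact: continuous_of_unit.
Qed.

Let cmin (f g : I -> R) : continuous f -> continuous g ->
  continuous (fun s => Num.min (f s) (g s)).
Proof.
by move=> cf cg s; apply: (@continuous_min R I f g); [exact: cf|exact: cg].
Qed.

Let cmax (f g : I -> R) : continuous f -> continuous g ->
  continuous (fun s => Num.max (f s) (g s)).
Proof.
by move=> cf cg s; apply: (@continuous_max R I f g); [exact: cf|exact: cg].
Qed.

Let ccst (c : R) : continuous (fun _ : I => c).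
Proof. exact: cst_continuous. Qed.

Lemma concatA_homotopic w x y z (p : {path I from w to x})
    (q : {path I from x to y}) (r : {path I from y to z}) :
  path_homotopic (concat p (concat q r)) (concat (concat p q) r).
Proof.
pose v (s : I) : R := Num.min (Num.min (2 * of_unit s + 0)
  (1 * of_unit s + 4^-1)) (2^-1 * of_unit s + 2^-1).
apply: (@reparam_homotopic _ _ (concat p (concat q r)) (@of_unit R) v).
- exact: cts_fun.
- exact: continuous_of_unit.
- by apply: cmin; [apply: cmin|]; exact: ct.
- by rewrite /v of_unit0; rewrite !minElt; do ![case: ifP]; lra.
- by rewrite /v of_unit1; rewrite !minElt; do ![case: ifP]; lra.
- by move=> s; rewrite of_unitK.
move=> s; have /andP[s0 s1] := of_unit_itv s.
have [s4|s4] := leP (of_unit s) 4^-1.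
  have -> : v s = 2 * of_unit s by rewrite /v !minElt; do ![case: ifP]; lra.
  rewrite /= /mk_path /concat_fun clampK; last lra.
  rewrite ifT; last lra.
  rewrite [RHS]ifT; last lra.
  by rewrite /= /mk_path /concat_fun clampK ?ifT //; lra.
have [s2|s2] := leP (of_unit s) 2^-1.
  have -> : v s = of_unit s + 4^-1 by rewrite /v !minElt; do ![case: ifP]; lra.
  rewrite /= /mk_path /concat_fun clampK; last lra.
  rewrite ifT; last lra.
  rewrite [RHS]ifF; last by apply/negbTE; rewrite -ltNge; lra.
  rewrite /= /mk_path /concat_fun !clampK; [|lra|lra].
  rewrite ifF; last by apply/negbTE; rewrite -ltNge; lra.
  rewrite ifT; last lra.
  by congr (q (clamp _)); lra.
have -> : v s = 2^-1 * of_unit s + 2^-1.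
  by rewrite /v !minElt; do ![case: ifP]; lra.
rewrite /= /mk_path /concat_fun clampK; last lra.
rewrite ifF; last by apply/negbTE; rewrite -ltNge; lra.
rewrite [RHS]ifF; last by apply/negbTE; rewrite -ltNge; lra.
rewrite /= /mk_path /concat_fun !clampK; last lra.
rewrite ifF; last by apply/negbTE; rewrite -ltNge; lra.
by congr (r (clamp _)); lra.
Qed.

Lemma concat1p_homotopic x y (p : {path I from x to y}) :
  path_homotopic (concat (const_path x) p) p.
Proof.
apply: path_homotopic_sym.
pose v (s : I) : R := Num.max 0 (2 * of_unit s - 1).
apply: (@reparam_homotopic _ _ p (@of_unit R) v).
- exact: cts_fun.
- exact: continuous_of_unit.
- by apply: cmax; [exact: ccst|exact: ct].
- by rewrite /v of_unit0 maxElt; case: ifP; lra.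
- by rewrite /v of_unit1 maxElt; case: ifP; lra.
- by move=> s; rewrite of_unitK.
move=> s; have /andP[s0 s1] := of_unit_itv s.
rewrite /= /mk_path /concat_fun; case: leP => s2.
  have -> : v s = 0 by rewrite /v maxElt; case: ifP; lra.
  by rewrite [RHS]path_zero.
by have -> : v s = 2 * of_unit s - 1 by rewrite /v maxElt; case: ifP; lra.
Qed.

Lemma concatp1_homotopic x y (p : {path I from x to y}) :
  path_homotopic (concat p (const_path y)) p.
Proof.
apply: path_homotopic_sym.
pose v (s : I) : R := Num.min (2 * of_unit s + 0) 1.
apply: (@reparam_homotopic _ _ p (@of_unit R) v).
- exact: cts_fun.
- exact: continuous_of_unit.
- by apply: cmin; [exact: ct|exact: ccst].
- by rewrite /v of_unit0 minElt; case: ifP; lra.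
- by rewrite /v of_unit1 minElt; case: ifP; lra.
- by move=> s; rewrite of_unitK.
move=> s; have /andP[s0 s1] := of_unit_itv s.
rewrite /= /mk_path /concat_fun; case: leP => s2.
  by have -> : v s = 2 * of_unit s by rewrite /v minElt; case: ifP; lra.
have -> : v s = 1 by rewrite /v minElt; case: ifP; lra.
by rewrite [RHS]path_one.
Qed.

Lemma concatpV_homotopic x y (p : {path I from x to y}) :
  path_homotopic (concat p (reverse p)) (const_path x).
Proof.
apply: path_homotopic_sym.
pose v (s : I) : R := Num.min (2 * of_unit s + 0) (- 2 * of_unit s + 2).
apply: (@reparam_homotopic _ _ p (fun=> 0) v).
- exact: cts_fun.
- exact: ccst.
- by apply: cmin; exact: ct.
- by rewrite /v of_unit0 minElt; case: ifP; lra.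
- by rewrite /v of_unit1 minElt; case: ifP; lra.
- by move=> s; rewrite [RHS]path_zero.
move=> s; have /andP[s0 s1] := of_unit_itv s.
rewrite /= /mk_path /concat_fun; case: leP => s2.
  by have -> : v s = 2 * of_unit s by rewrite /v minElt; case: ifP; lra.
rewrite /= /mk_path /reverse_fun clampK; last lra.
by congr (p (clamp _)); rewrite /v minElt; case: ifP; lra.
Qed.

Lemma concatVp_homotopic x y (p : {path I from x to y}) :
  path_homotopic (concat (reverse p) p) (const_path y).
Proof.
apply: path_homotopic_sym.
pose v (s : I) : R := Num.max (- 2 * of_unit s + 1) (2 * of_unit s - 1).
apply: (@reparam_homotopic _ _ p (fun=> 1) v).
- exact: cts_fun.
- exact: ccst.
- by apply: cmax; exact: ct.
- by rewrite /v of_unit0 maxElt; case: ifP; lra.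
- by rewrite /v of_unit1 maxElt; case: ifP; lra.
- by move=> s; rewrite [RHS]path_one.
move=> s; have /andP[s0 s1] := of_unit_itv s.
rewrite /= /mk_path /concat_fun; case: leP => s2.
  rewrite /= /mk_path /reverse_fun clampK; last lra.
  by congr (p (clamp _)); rewrite /v maxElt; case: ifP; lra.
by have -> : v s = 2 * of_unit s - 1 by rewrite /v maxElt; case: ifP; lra.
Qed.

End Homotopy.

Section FundamentalGroup.
Variables (R : realType) (X : topologicalType) (x : X).
Local Notation loop := {path (unit_interval R) from x to x}.

Definition loop_homotopic (p q : loop) : bool := `[< path_homotopic p q >].

Lemma loop_homotopic_refl : reflexive loop_homotopic.
Proof. by move=> p; apply/asboolP; exact: path_homotopic_refl. Qed.

Lemma loop_homotopic_sym : symmetric loop_homotopic.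
Proof. by move=> p q; apply/asboolP/asboolP; exact: path_homotopic_sym. Qed.

Lemma loop_homotopic_trans : transitive loop_homotopic.
Proof.
move=> q p r /asboolP pq /asboolP qr; apply/asboolP.
exact: path_homotopic_trans qr.
Qed.

Canonical loop_homotopic_equiv := EquivRel loop_homotopic
  loop_homotopic_refl loop_homotopic_sym loop_homotopic_trans.

Definition fundamental_group : Type := {eq_quot loop_homotopic}.

HB.instance Definition _ := Choice.on fundamental_group.
HB.instance Definition _ := EqQuotient.on fundamental_group.

Local Notation pi1 := fundamental_group.

Lemma pi1P (p q : loop) : \pi_pi1 p = \pi_pi1 q <-> path_homotopic p q.
Proof.
by split => [/eqmodP/asboolP|pq] //; apply/eqmodP/asboolP.
Qed.

Lemma pi1_repr (p : loop) : path_homotopic (repr (\pi_pi1 p)) p.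
Proof. by apply/pi1P; rewrite reprK. Qed.

Definition pi1_one : pi1 := \pi_pi1 (const_path R x).

Definition pi1_mul (a b : pi1) : pi1 := \pi_pi1 (concat (repr a) (repr b)).

Definition pi1_inv (a : pi1) : pi1 := \pi_pi1 (reverse (repr a)).

Lemma pi1_mulE p q : pi1_mul (\pi_pi1 p) (\pi_pi1 q) = \pi_pi1 (concat p q).
Proof. by apply/pi1P; apply: concat_homotopic; exact: pi1_repr. Qed.

Lemma pi1_invE p : pi1_inv (\pi_pi1 p) = \pi_pi1 (reverse p).
Proof. by apply/pi1P; apply: reverse_homotopic; exact: pi1_repr. Qed.

Lemma pi1_mulA : associative pi1_mul.
Proof.
elim/quotW => p; elim/quotW => q; elim/quotW => r.
rewrite (pi1_mulE q r) (pi1_mulE p (concat q r)) (pi1_mulE p q).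
by rewrite (pi1_mulE (concat p q) r); apply/pi1P; exact: concatA_homotopic.
Qed.

Lemma pi1_mul1 : left_id pi1_one pi1_mul.
Proof.
by elim/quotW => p; rewrite pi1_mulE; apply/pi1P; exact: concat1p_homotopic.
Qed.

Lemma pi1_1mul : right_id pi1_one pi1_mul.
Proof.
by elim/quotW => p; rewrite pi1_mulE; apply/pi1P; exact: concatp1_homotopic.
Qed.

Lemma pi1_mulV : left_inverse pi1_one pi1_inv pi1_mul.
Proof.
elim/quotW => p; rewrite pi1_invE pi1_mulE; apply/pi1P.
exact: concatVp_homotopic.
Qed.

Lemma pi1_Vmul : right_inverse pi1_one pi1_inv pi1_mul.
Proof.
elim/quotW => p; rewrite pi1_invE pi1_mulE; apply/pi1P.
exact: concatpV_homotopic.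
Qed.

HB.instance Definition _ := isGroup.Build fundamental_group
  pi1_mulA pi1_mul1 pi1_1mul pi1_mulV pi1_Vmul.

End FundamentalGroup.

Definition semilocally_1_connected (R : realType) (X : topologicalType) :
    Prop :=
  forall x : X, exists2 U, nbhs x U &
    forall p : {path (unit_interval R) from x to x},
      (forall t, U (p t)) -> path_homotopic p (const_path R x).

Section SymmetricSquare.
Variable X : topologicalType.

(* [v] is in the orbit of [u] for the action of Z_2 interchanging factors. *)
Definition swap_orbit (u v : X * X) : bool :=
  (v == u) || (v == (u.2, u.1)).

Lemma swap_orbit_refl : reflexive swap_orbit.
Proof. by move=> u; rewrite /swap_orbit eqxx. Qed.

Lemma swap_orbit_sym : symmetric swap_orbit.
Proof.
move=> [a b] [c d]; rewrite /swap_orbit /= !xpair_eqE.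
by rewrite (eq_sym a) (eq_sym b) (eq_sym a) (eq_sym b) [X in _ || X]andbC.
Qed.

Lemma swap_orbit_trans : transitive swap_orbit.
Proof.
move=> [c d] [a b] [e f]; rewrite /swap_orbit /=.
by case/orP=> /eqP[-> ->] //; rewrite orbC.
Qed.

Canonical swap_orbit_equiv := EquivRel swap_orbit
  swap_orbit_refl swap_orbit_sym swap_orbit_trans.

Definition symmetric_square : Type :=
  quotient_topology {eq_quot swap_orbit}.

HB.instance Definition _ := Topological.on symmetric_square.
HB.instance Definition _ := Quotient.on symmetric_square.

Definition diag_class (x : X) : symmetric_square :=
  \pi_symmetric_square (x, x).

End SymmetricSquare.

Section Abelianization.
Variable G : groupType.
Local Open Scope group_scope.

Definition commutator_subgroup : set G :=
  smallest (fun S : set G => group_closed (mem S))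
    [set commg a b | a in [set: G] & b in [set: G]].

Lemma commutator_subgroup_comm (a b : G) : commutator_subgroup (commg a b).
Proof. by apply: sub_gen_smallest; exists a => //; exists b. Qed.

Lemma commutator_subgroup1 : commutator_subgroup 1.
Proof. by move=> S [[+ _] _]; rewrite inE. Qed.

Lemma commutator_subgroupF (a b : G) :
  commutator_subgroup a -> commutator_subgroup b ->
  commutator_subgroup (a / b).
Proof.
move=> Da Db S SC; have [[_ SF] _] := SC.
by apply/set_mem; apply: SF; apply/mem_set; [exact: Da|exact: Db].
Qed.

Lemma commutator_subgroupV (a : G) :
  commutator_subgroup a -> commutator_subgroup a^-1.
Proof.
move=> Da; rewrite -[a^-1]mul1g.
by apply: commutator_subgroupF => //; exact: commutator_subgroup1.
Qed.

Lemma commutator_subgroupM (a b : G) :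
  commutator_subgroup a -> commutator_subgroup b ->
  commutator_subgroup (a * b).
Proof.
move=> Da Db; rewrite -[b]invgK.
by apply: commutator_subgroupF => //; exact: commutator_subgroupV.
Qed.

Lemma commutator_subgroupJ (a b : G) :
  commutator_subgroup a -> commutator_subgroup (a ^ b).
Proof.
move=> Da; rewrite -[a ^ b]mul1g -(mulgV a) -mulgA.
apply: commutator_subgroupM => //.
by rewrite -/(commg a b); exact: commutator_subgroup_comm.
Qed.

Definition ab_rel (a b : G) : bool := `[< commutator_subgroup (a^-1 * b) >].

Lemma ab_rel_refl : reflexive ab_rel.
Proof.
by move=> a; apply/asboolP; rewrite mulVg; exact: commutator_subgroup1.
Qed.

Lemma ab_rel_sym : symmetric ab_rel.
Proof.
by move=> a b; apply/asboolP/asboolP => /commutator_subgroupV;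
  rewrite invgM invgK.
Qed.

Lemma ab_rel_trans : transitive ab_rel.
Proof.
move=> b a c /asboolP ab /asboolP bc; apply/asboolP.
by have := commutator_subgroupM ab bc; rewrite mulgA mulgK.
Qed.

Canonical ab_rel_equiv := EquivRel ab_rel ab_rel_refl ab_rel_sym ab_rel_trans.

Definition abelianization : Type := {eq_quot ab_rel}.

HB.instance Definition _ := Choice.on abelianization.
HB.instance Definition _ := EqQuotient.on abelianization.

Local Notation ab := abelianization.

Lemma abP (a b : G) :
  \pi_ab a = \pi_ab b <-> commutator_subgroup (a^-1 * b).
Proof. by split => [/eqmodP/asboolP|h] //; apply/eqmodP/asboolP. Qed.

Definition ab_one : ab := \pi_ab 1.
Definition ab_mul (u v : ab) : ab := \pi_ab (repr u * repr v).
Definition ab_inv (u : ab) : ab := \pi_ab (repr u)^-1.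

Lemma ab_mulE (a b : G) : ab_mul (\pi_ab a) (\pi_ab b) = \pi_ab (a * b).
Proof.
apply/abP.
have := erefl (\pi_ab a); rewrite -{1}(reprK (\pi_ab a)) => /abP.
have := erefl (\pi_ab b); rewrite -{1}(reprK (\pi_ab b)) => /abP.
set a' := repr (\pi_ab a); set b' := repr (\pi_ab b) => Db Da.
have -> : (a' * b')^-1 * (a * b) = (a'^-1 * a) ^ b' * (b'^-1 * b).
  by rewrite invgM /conjg !mulgA mulgK.
by apply: commutator_subgroupM => //; exact: commutator_subgroupJ.
Qed.

Lemma ab_invE (a : G) : ab_inv (\pi_ab a) = \pi_ab a^-1.
Proof.
apply/abP.
have := erefl (\pi_ab a); rewrite -{1}(reprK (\pi_ab a)) => /abP.
move: (repr _) => a' Da; rewrite invgK.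
have -> : a' * a^-1 = ((a'^-1 * a) ^ a'^-1)^-1.
  by rewrite /conjg invgK !mulgA mulgV mul1g invgM invgK.
by apply: commutator_subgroupV; exact: commutator_subgroupJ.
Qed.

Lemma ab_mulA : associative ab_mul.
Proof.
elim/quotW => a; elim/quotW => b; elim/quotW => c.
rewrite (ab_mulE b c) (ab_mulE a (b * c)) (ab_mulE a b).
by rewrite (ab_mulE (a * b) c) mulgA.
Qed.

Lemma ab_mul1 : left_id ab_one ab_mul.
Proof. by elim/quotW => a; rewrite ab_mulE mul1g. Qed.

Lemma ab_1mul : right_id ab_one ab_mul.
Proof. by elim/quotW => a; rewrite ab_mulE mulg1. Qed.

Lemma ab_mulV : left_inverse ab_one ab_inv ab_mul.
Proof. by elim/quotW => a; rewrite ab_invE ab_mulE mulVg. Qed.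

Lemma ab_Vmul : right_inverse ab_one ab_inv ab_mul.
Proof. by elim/quotW => a; rewrite ab_invE ab_mulE mulgV. Qed.

HB.instance Definition _ := isGroup.Build abelianization
  ab_mulA ab_mul1 ab_1mul ab_mulV ab_Vmul.

Lemma abelianizationC (u v : abelianization) : u * v = v * u.
Proof.
move: u v.
elim/quotW => a; elim/quotW => b; rewrite [LHS]ab_mulE [RHS]ab_mulE.
apply/abP; rewrite invgM -mulgA; exact: commutator_subgroup_comm.
Qed.

End Abelianization.

Definition group_isomorphic (G H : groupType) : Prop :=
  exists f : {multiplicative G -> H}, bijective f.

(* Main.v *)
(* Send a loop [p] at [x] to the image of [(p, x)] in the symmetric square. The
   product of the images of [p] and [q] is the image of the loop [(p, q)], which
   is symmetric in [p] and [q], so this homomorphism factors through the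
   abelianisation.
   Surjectivity is path lifting: the projection is a double cover off the
   diagonal, and at diagonal points every set-theoretic lift of a path is
   continuous.
   Injectivity: homotopies need not lift, but the holonomy of a path of
   [X * X], i.e. the product in the abelianisation of the classes of its two
   coordinates closed up by fixed paths from [x], depends only on the image
   path, up to homotopy. Near each point of the homotopy square the holonomy of
   a lift is the increment of a function of the image of its end point in the
   symmetric square, because loops in a small set are trivial; hence the
   increments cancel around every small rectangle, whatever lifts are chosen
   for its sides, and rectangles can be chained in both directions. *)
From HB Require Import structures.
Require Import Defs.
From mathcomp Require Import all_boot all_order all_algebra.
From mathcomp Require Import all_classical all_reals topology.
From mathcomp Require Import normedtype continuous_path.
From mathcomp Require Import lra.

Set Implicit Arguments.
Unset Strict Implicit.
Unset Printing Implicit Defensive.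

Import Order.TTheory GRing.Theory Num.Theory.
Import numFieldNormedType.Exports.

Local Open Scope classical_set_scope.
Local Open Scope ring_scope.
Local Open Scope quotient_scope.

(** * Real induction and double covers of subsets of the line *)

Section RealInduction.
Variable R : realType.
Implicit Types t u v w : R.

Lemma near_dist (t : R) (P : set R) :
  (\forall u \near t, P u) -> exists2 e, 0 < e & forall u, `|t - u| < e -> P u.
Proof. by move=> /nbhs_ballP[e /= e0 eP]; exists e => // u /eP. Qed.

(** Real induction: the [t] with [P a t] go past their supremum unless it is [b], since [P] holds
    between points close to it. This plays the role of subdividing [[a, b]] by a Lebesgue number. *)
Lemma chain_ind (P : R -> R -> Prop) (a b : R) : a <= b ->
  (forall t u v, a <= t -> t <= u -> u <= v -> v <= b ->
     P t u -> P u v -> P t v) ->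
  (forall t, a <= t -> t <= b -> exists2 e, 0 < e &
     forall u v, a <= u -> u <= v -> v <= b -> `|t - u| < e -> `|t - v| < e ->
       P u v) ->
  P a b.
Proof.
move=> ab Ptrans Ploc.
pose S := [set t | [/\ a <= t, t <= b & P a t]].
have Sa : S a.
  split=> //; have [e e0 ae] := Ploc a (lexx a) ab.
  by apply: ae => //; rewrite subrr normr0.
have supS : has_sup S by split; [exists a|exists b => t []].
have aS : a <= sup S by apply: (ub_le_sup supS.2).
have Sb : sup S <= b by apply: ge_sup; [exists a|move=> t []].
have [e e0 eP] := Ploc _ aS Sb.
have [t [at_ tb Pat] tS] := sup_adherent e0 supS.
have tleS : t <= sup S by apply: (ub_le_sup supS.2).
have dt : `|sup S - t| < e by rewrite ger0_norm; lra.
(* [t] lies in [S] within [e] of the supremum, and [v] lies strictly beyond the supremum unless [b]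
   stops it. *)
pose v := Num.min b (sup S + e / 2).
have Sv : sup S <= v by rewrite le_min Sb; lra.
have vb : v <= b by rewrite ge_min lexx.
have ve : v <= sup S + e / 2 by rewrite ge_min lexx orbT.
have dv : `|sup S - v| < e by rewrite distrC ger0_norm; lra.
have Pav : P a v.
  apply: (Ptrans _ t) => //; first lra.
  by apply: eP => //; lra.
have : v <= sup S by apply: (ub_le_sup supS.2); split => //; lra.
rewrite /v ge_min => /orP[bS|]; last lra.
by move: Pav; rewrite /v min_l //; lra.
Qed.

Definition between (a b t : R) : bool := (a <= t <= b) || (b <= t <= a).

Lemma betweenr a b : between a b b.
Proof. by rewrite /between !lexx /= andbT orbC le_total. Qed.

Lemma betweenC a b t : between a b t = between b a t.
Proof. by rewrite /between orbC. Qed.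

Lemma between_split a b c t :
  between a c t -> between a b t || between b c t.
Proof.
rewrite /between => /orP[]/andP[h k]; have [tb|/ltW bt] := leP t b;
  by rewrite ?h ?k ?bt ?orbT ?andbT.
Qed.

Lemma between_ball c e a b t :
  `|c - a| < e -> `|c - b| < e -> between a b t -> `|c - t| < e.
Proof.
by rewrite !ltr_norml /between => /andP[? ?] /andP[? ?] /orP[]/andP[? ?];
  apply/andP; split; lra.
Qed.

(* [good s t] is a germ-local condition on sign functions, determined up to a
   global sign: the lemma says that a double cover of an open subset of the
   line is trivial. *)
Lemma sign_choice (C : set R) (good : (R -> bool) -> R -> Prop) :
  closed C ->
  (forall s s' t, (\forall u \near t, s' u = s u) -> good s t -> good s' t) ->
  (forall b s t, good s t -> good (fun u => b (+) s u) t) ->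
  (forall s s' t, ~ C t -> good s t -> good s' t -> s t = s' t ->
     \forall u \near t, s u = s' u) ->
  (forall t, ~ C t -> exists s, \forall u \near t, good s u) ->
  exists s, forall t, ~ C t -> good s t.
Proof.
move=> clC germ flip coh loc.
have openC t : ~ C t -> \forall u \near t, ~ C u.
  by move=> nCt; have := open_nbhs_nbhs (conj (closed_openC clC) nCt).
have segle a b : a <= b -> (forall t, a <= t -> t <= b -> ~ C t) ->
    exists s, forall t, a <= t -> t <= b -> good s t.
  move=> ab nC; apply: (chain_ind
    (P := fun u v => exists s, forall t, u <= t -> t <= v -> good s t)) => //.
  - move=> t u v at_ tu uv vb [s sP] [s' s'P].
    (* A constant twist makes the second function agree with the first at [u]; by coherence they
       then agree near [u], so the glued function has the germ of [s] there. *)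
    pose c := s u (+) s' u; pose s2 w := c (+) s' w.
    have s2P w : u <= w -> w <= v -> good s2 w.
      by move=> uw wv; apply: flip; exact: s'P.
    have s2u : s u = s2 u by rewrite /s2 /c -addbA addbb addbF.
    exists (fun w => if w <= u then s w else s2 w) => w tw wv.
    have [wu|uw|->] := ltgtP w u.
    + apply: germ (sP w tw (ltW wu)).
      near=> y; rewrite ifT //; apply: ltW; near: y; exact: lt_nbhsl.
    + apply: germ (s2P w (ltW uw) wv).
      near=> y; rewrite ifF //; apply/negbTE; rewrite -ltNge; near: y.
      exact: lt_nbhsr.
    + apply: germ (sP u tu (lexx u)).
      have := coh s s2 u (nC u _ _) (sP u tu (lexx u)) (s2P u (lexx u) uv) s2u.
      move=> /(_ (le_trans at_ tu) (le_trans uv vb)).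
      by apply: filterS => y ->; case: ifP.
  - move=> t at_ tb; have [s /near_dist[e e0 eP]] := loc t (nC t at_ tb).
    exists e => // u v au uv vb tu tv; exists s => w uw wv; apply: eP.
    by apply: (between_ball tu tv); rewrite /between uw wv.
have seg a b : (forall t, between a b t -> ~ C t) ->
    exists s, forall t, between a b t -> good s t.
  have [ab nC|/ltW ba nC] := leP a b.
    have [|s sP] := segle a b ab.
      by move=> t at_ tb; apply: nC; rewrite /between at_ tb.
    exists s => t /orP[]/andP[? ?]; apply: sP => //; lra.
  have [|s sP] := segle b a ba.
    by move=> t at_ tb; apply: nC; rewrite /between at_ tb orbT.
  by exists s => t /orP[]/andP[? ?]; apply: sP => //; lra.
have cstle s s' a b : a <= b -> (forall t, a <= t -> t <= b ->
    [/\ ~ C t, good s t & good s' t]) -> s a (+) s' a = s b (+) s' b.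
  move=> ab sP.
  apply: (chain_ind (P := fun u v => s u (+) s' u = s v (+) s' v)) => //.
    by move=> t u v _ _ _ _ -> ->.
  move=> t at_ tb; have [nC st s't] := sP t at_ tb.
  pose s2 w := (s t (+) s' t) (+) s' w.
  have : s t = s2 t by rewrite /s2 -addbA addbb addbF.
  move=> /(coh s s2 t nC st (flip _ _ _ s't))/near_dist[e e0 eP].
  exists e => // u v _ _ _ /eP -> /eP ->.
  by rewrite /s2 -!addbA !addbb.
have cst s s' a b : (forall t, between a b t ->
    [/\ ~ C t, good s t & good s' t]) -> s a (+) s' a = s b (+) s' b.
  move=> sP; have [ab|/ltW ba] := leP a b.
    by apply: cstle => // t ? ?; apply: sP; rewrite /between; apply/orP; left;
      apply/andP.
  apply/esym/cstle => // t ? ?; apply: sP; rewrite /between; apply/orP; right.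
  exact/andP.
(* For [a] outside [C] this is its connected component in the complement of [C]. Points of one
   component have equal [comp], so [r] gives them the same base point. *)
pose comp a := [set b | forall t, between a b t -> ~ C t].
have compS a b : comp a b -> comp b a.
  by move=> ab t; rewrite betweenC => /ab.
have compT a b c : comp a b -> comp b c -> comp a c.
  by move=> ab bc t /(between_split b)/orP[/ab|/bc].
pose r t := xget 0 (comp t).
have compr t : ~ C t -> comp t (r t).
  move=> nCt; apply: (@xgetPex _ 0 (comp t)); exists t => u.
  by rewrite /between orbb -eq_le => /eqP <-.
have rE a b : comp a b -> r a = r b.
  move=> ab; have ab' : comp a = comp b.
    by apply/seteqP; split=> c; [apply: compT; exact: compS|exact: compT].
  by rewrite /r ab'.
have /choice[S SP] : forall t, exists s, ~ C t ->
    forall u, between (r t) t u -> good s u.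
  move=> t; have [Ct|nCt] := pselect (C t); first by exists (fun=> true).
  by have [s sP] := seg _ _ (compS _ _ (compr t nCt)); exists s.
(* The change of sign of [S t] from the base point to [t] does not depend on which [S t] was chosen.
   Near [t0] it is compared with a local good [s], up to a constant sign. *)
exists (fun t => S t (r t) (+) S t t) => t0 nC0.
have [s sP] := loc t0 nC0.
set s0 := S t0 (r t0) (+) S t0 t0.
apply: (germ (fun t => (s0 (+) s t0) (+) s t)); last first.
  by apply: flip; exact: nbhs_singleton sP.
have [e e0 eP] := near_dist (filterI sP (openC t0 nC0)).
apply/nbhs_ballP; exists e => //= t tt0.
have bt u : between t0 t u -> good s u /\ ~ C u.
  by move=> tu; apply: eP; apply: (between_ball _ _ tu) => //;
    rewrite subrr normr0.
have ct : comp t0 t by move=> u /bt[].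
have nCt : ~ C t by apply: ct; exact: betweenr.
have rt := rE _ _ ct.
have c0 := compS _ _ (compr _ nC0).
have c1 := compS _ _ (compr _ nCt); rewrite -rt in c1.
(* The hull of [r t0], [t0] and [t] avoids [C], so one good [z] lives on all of it; [S t0], [S t]
   and [s] each differ from [z] by a constant sign. *)
pose m := Num.min (r t0) (Num.min t0 t).
pose M := Num.max (r t0) (Num.max t0 t).
have hull u : between m M u -> between (r t0) t0 u || between t0 t u.
  rewrite /between /m /M !ge_min !le_max !ge_max !le_min.
  have := le_total u (r t0); have := le_total u t0; have := le_total u t.
  by do 6![case: (_ <= _)].
have [|z zP] := seg m M.
  by move=> u /hull/orP[/c0|/ct].
have sub a b u : a \in [:: r t0; t0; t] -> b \in [:: r t0; t0; t] ->
    between a b u -> between m M u.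
  have mM : forall x, x \in [:: r t0; t0; t] -> m <= x <= M.
    by move=> x; rewrite !inE /m /M !ge_min !le_max => /or3P[]/eqP ->;
       rewrite !lexx ?orbT.
  move=> /mM/andP[ma aM] /mM/andP[mb bM].
  by rewrite /between => /orP[]/andP[? ?]; apply/orP; left; apply/andP; split;
    lra.
have e1 : S t0 (r t0) (+) z (r t0) = S t0 t0 (+) z t0.
  apply: cst => u bu; split; [exact: c0|exact: SP|].
  by apply/zP/(sub _ _ _ _ _ bu); rewrite !inE eqxx ?orbT.
have e2 : S t (r t0) (+) z (r t0) = S t t (+) z t.
  apply: cst => u bu; split; [exact: c1|by apply: SP => //; rewrite -rt|].
  by apply/zP/(sub _ _ _ _ _ bu); rewrite !inE eqxx ?orbT.
have e3 : s t0 (+) z t0 = s t (+) z t.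
  apply: cst => u bu; have [? ?] := bt _ bu; split => //.
  by apply/zP/(sub _ _ _ _ _ bu); rewrite !inE eqxx ?orbT.
rewrite -rt /s0; move: e1 e2 e3.
by case: (S t0 _); case: (S t0 _); case: (S t _); case: (S t _); case: (z _);
  case: (z _); case: (z _); case: (s t0); case: (s t).
Unshelve. all: by end_near. Qed.

End RealInduction.

(** * Path lifting to the symmetric square *)

Section SymmetricSquareTopology.
Variable X : topologicalType.
Implicit Types u v : X * X.

Definition swap u : X * X := (u.2, u.1).

Lemma swapK : involutive swap.
Proof. by case. Qed.

Definition sq u : symmetric_square X := \pi_(symmetric_square X) u.

Lemma sqE u v : sq u = sq v <-> v = u \/ v = swap u.
Proof.
split=> [/eqmodP/orP[]/eqP ->|uv]; [by left|by right|].
by apply/eqmodP; rewrite /= /swap_orbit; case: uv => ->; rewrite eqxx ?orbT.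
Qed.

Lemma sq_swap u : sq (swap u) = sq u.
Proof. by apply/sqE; right; rewrite swapK. Qed.

Lemma sq_continuous : continuous sq.
Proof. exact: pi_continuous. Qed.

Lemma sq_surj c : exists u, sq u = c.
Proof. by exists (repr c); rewrite /sq reprK. Qed.

Lemma swap_continuous : continuous swap.
Proof. by move=> u; apply: cvg_pair; [exact: cvg_snd|exact: cvg_fst]. Qed.

Lemma open_sq (O : set (X * X)) : open O -> open (sq @` O).
Proof.
move=> oO; rewrite /open /= /quotient_open.
rewrite (_ : _ @^-1` _ = O `|` swap @^-1` O).
  by apply: openU => //; apply: open_comp => // u _; exact: swap_continuous.
apply/seteqP; split=> [u [v Ov /sqE[->|->]]|u [Ou|Ou]] /=.
- by left.
- by right; rewrite /preimage /= swapK.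
- by exists u.
- by exists (swap u); rewrite // sq_swap.
Qed.

(** As [sq] is open, points near [d t] have a preimage in [A], and that preimage is [f s] or its
    swap. Continuity is asked of [d] only, not of the lift [f]. *)
Lemma sq_lift_near (T : topologicalType) (d : T -> symmetric_square X)
    (f : T -> X * X) (t : T) (A : set (X * X)) :
  {for t, continuous d} -> (forall s, sq (f s) = d s) -> nbhs (f t) A ->
  \forall s \near t, A (f s) \/ A (swap (f s)).
Proof.
move=> cd fd; rewrite nbhsE => -[O [oO Of] OA].
have : nbhs (d t) (sq @` O).
  apply: (@open_nbhs_nbhs (symmetric_square X)).
  by split; [exact: open_sq|exists (f t)].
move=> /cd dO; apply: (filterS _ (dO : nbhs t (d @^-1` (sq @` O)))) => s [u Ou].
rewrite -fd => /sqE[->|->].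
  by left; exact: OA.
by right; rewrite swapK; exact: OA.
Qed.

(** Take the product of disjoint neighbourhoods of the two coordinates. Such an [A] meets each orbit
    at most once: it is a sheet of the double cover. *)
Lemma hausdorff_off_diagonal u : hausdorff_space X -> u.1 <> u.2 ->
  exists A, [/\ open A, A u & forall v, A v -> ~ A (swap v)].
Proof.
rewrite open_hausdorff => hX /eqP u12.
have [[U V] /= [uU vV] [oU oV UV0]] := hX _ _ u12.
move: uU vV; rewrite !inE => uU vV.
exists (fst @^-1` U `&` snd @^-1` V); split => //.
  apply: openI.
    by apply: open_comp => // v _; exact: cvg_fst.
  by apply: open_comp => // v _; exact: cvg_snd.
move=> [a b] [/= Ua Vb] [/= Ub Va].
by move/eqP: UV0; rewrite -subset0 => /(_ a); apply.
Qed.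

End SymmetricSquareTopology.

Arguments swap {X} u.
Arguments sq {X} u.

Section PathLifting.
Variables (R : realType) (X : topologicalType).
Hypothesis hausX : hausdorff_space X.

(* Off the diagonal the projection [sq] is a double cover, and on the diagonal
   every set-theoretic lift is continuous. *)
Lemma sq_lift (d : R -> symmetric_square X) : continuous d ->
  exists2 f : R -> X * X, continuous f & forall t, sq (f t) = d t.
Proof.
move=> cd.
pose lift (s : R -> bool) t := if s t then repr (d t) else swap (repr (d t)).
have liftE s t : sq (lift s t) = d t.
  by rewrite /lift; case: (s t); rewrite ?sq_swap /sq reprK.
pose C := [set t | (repr (d t)).1 = (repr (d t)).2].
have offdiag s t : ~ C t -> (lift s t).1 <> (lift s t).2.
  by rewrite /lift /C /=; case: (s t) => //= ? /esym.
have [|||||s sP] := @sign_choice R C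
    (fun s t => {for t, continuous (lift s)}).
(* [C] is closed: near an off-diagonal point the lift or its swap lies in a sheet [A], and a
   diagonal point, being its own swap, cannot. *)
- rewrite -openC openE => t nCt.
  have [A [oA At AS]] :=
    hausdorff_off_diagonal hausX (offdiag (fun=> true) t nCt).
  have tA := open_nbhs_nbhs (conj oA At).
  apply: filterS (sq_lift_near (cd t) (liftE (fun=> true)) tA) => u.
  rewrite /lift /= /C /setC /= => Au uC.
  have uS : swap (repr (d u)) = repr (d u).
    by move: uC; rewrite /swap; case: (repr _) => a b /= ->.
  by case: Au; rewrite ?uS => Au; apply: (AS _ Au); rewrite uS.
- move=> s s' t ss' cs B tB.
  have ft : lift s' t = lift s t by rewrite /lift (nbhs_singleton ss').
  rewrite ft in tB; rewrite near_simpl; apply: filterS2 ss' (cs B tB) => u.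
  by rewrite /preimage /= /lift => ->.
- move=> [] s t cs /=; last first.
    by rewrite (_ : lift _ = lift s).
  rewrite (_ : lift _ = @swap X \o lift s).
    by apply: continuous_comp => //; exact: swap_continuous.
  by apply/funext => u; rewrite /lift /=; case: (s u); rewrite //= swapK.
- move=> s s' t nCt cs cs' st.
  have [A [oA At AS]] := hausdorff_off_diagonal hausX (offdiag s t nCt).
  have tA := open_nbhs_nbhs (conj oA At).
  have tA' : nbhs (lift s' t) A by rewrite /lift -st.
  have sA : \forall u \near t, A (lift s u) := cs _ tA.
  have s'A : \forall u \near t, A (lift s' u) := cs' _ tA'.
  apply: filterS2 sA s'A => u.
  rewrite /lift; case: (s u); case: (s' u) => // Au Au'.
    by case: (AS _ Au).
  by case: (AS _ Au').
- move=> t nCt.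
  have [A [oA At AS]] :=
    hausdorff_off_diagonal hausX (offdiag (fun=> true) t nCt).
  have tA := open_nbhs_nbhs (conj oA At).
  have uA := sq_lift_near (cd t) (liftE (fun=> true)) tA.
  (* The sign selects the preimage in the sheet [A]. The lift stays in [A] near [t], which makes it
     continuous at all nearby points. *)
  pose s u : bool := `[< A (repr (d u)) >].
  exists s.
  have liftA : \forall u \near t, A (lift s u).
    apply: filterS uA => u; rewrite /lift /s.
    by case: asboolP => // nA [].
  apply: filterS (nbhs_interior liftA) => u uAs B uB.
  have uAB : nbhs (lift s u) (A `&` B).
    apply: filterI => //; apply: open_nbhs_nbhs; split => //.
    exact: nbhs_singleton uAs.
  have h := sq_lift_near (cd u) (liftE s) uAB.
  rewrite near_simpl; apply: filterS2 h uAs => v [[]//|[Av Bv] Av'].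
  by case: (AS _ Av').
exists (lift s) => // t; have [Ct|nCt] := pselect (C t); last exact: sP.
move=> B tB.
(* Neighbourhoods of a point fixed by [swap] can be made symmetric, and then it does not matter
   which preimage the lift takes. *)
have fix_t : swap (lift s t) = lift s t.
  by rewrite /lift /swap; move: Ct; rewrite /C /=;
    case: (s t) => /=; case: (repr _) => a b /= ->.
have tB' : nbhs (lift s t) (B `&` (@swap X @^-1` B)).
  apply: filterI => //; apply: swap_continuous; rewrite fix_t.
  exact: tB.
apply: filterS (sq_lift_near (cd t) (liftE s) tB') => u [[]//|[_]].
by rewrite /preimage /= swapK.
Qed.

End PathLifting.

(** * Holonomy of paths *)

Section Paths.
Variables (R : realType) (X : topologicalType).
Local Notation I := (unit_interval R).

(** The straight-line homotopy between two plane curves, pushed forward by [F]. Two parameters are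
    needed later to move the coordinates of a pair of loops independently. *)
Lemma straight_homotopic (F : R * R -> X) (u1 u2 v1 v2 : I -> R) (y z : X)
    (p q : {path I from y to z}) :
  continuous F -> continuous u1 -> continuous u2 ->
  continuous v1 -> continuous v2 ->
  (u1 zero, u2 zero) = (v1 zero, v2 zero) ->
  (u1 one, u2 one) = (v1 one, v2 one) ->
  (forall s, p s = F (u1 s, u2 s)) -> (forall s, q s = F (v1 s, v2 s)) ->
  path_homotopic p q.
Proof.
move=> cF cu1 cu2 cv1 cv2 [z1 z2] [o1 o2] pE qE.
pose line (u v : I -> R) (st : I * I) :=
  (1 - of_unit st.2) * u st.1 + of_unit st.2 * v st.1.
have cline u v : continuous u -> continuous v -> continuous (line u v).
  move=> cu cv st.
  have c1 (w : I -> R) : continuous w ->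
      {for st, continuous (fun st : I * I => w st.1)}.
    move=> cw; apply: (continuous_comp (f := fst)); last exact: cw.
    exact: cvg_fst.
  have c2 (w : I -> R) : continuous w ->
      {for st, continuous (fun st : I * I => w st.2)}.
    move=> cw; apply: (continuous_comp (f := snd)); last exact: cw.
    exact: cvg_snd.
  apply: (@continuousD R R _
    (fun st : I * I => (1 - of_unit st.2) * u st.1)
    (fun st : I * I => of_unit st.2 * v st.1)).
    apply: (@continuousM R _ (fun st : I * I => 1 - of_unit st.2)
      (fun st : I * I => u st.1)); last exact: c1.
    exact: (c2 _ (@continuous_opp_unit R)).
  apply: (@continuousM R _ (fun st : I * I => of_unit st.2)
    (fun st : I * I => v st.1)); last exact: c1.
  exact: (c2 _ (@continuous_of_unit R)).
exists (fun st => F (line u1 v1 st, line u2 v2 st)); rewrite /line; split => /=.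
- by apply: continuous_pair_comp => //; exact: cline.
- by move=> s; rewrite of_unit0 subr0 !mul1r !mul0r !addr0 pE.
- by move=> s; rewrite of_unit1 subrr !mul0r !mul1r !add0r qE.
- move=> t; rewrite -z1 -z2 -!mulrDl subrK !mul1r -pE; exact: path_zero.
- move=> t; rewrite -o1 -o2 -!mulrDl subrK !mul1r -pE; exact: path_one.
Qed.

Section Segment.
Variables (f : R -> X) (cf : continuous f) (a b : R).

Definition segment_fun (s : I) : X := f ((b - a) * of_unit s + a).

Lemma segment_continuous : continuous segment_fun.
Proof.
move=> s; apply: (continuous_comp (f := fun s : I => (b - a) * of_unit s + a)).
  by apply: continuous_affine; exact: continuous_of_unit.
exact: cf.
Qed.

Lemma segment_zero : segment_fun zero = f a.
Proof. by rewrite /segment_fun of_unit0 mulr0 add0r. Qed.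

Lemma segment_one : segment_fun one = f b.
Proof. by rewrite /segment_fun of_unit1 mulr1 subrK. Qed.

Definition segment : {path I from f a to f b} :=
  mk_path segment_continuous segment_zero segment_one.

End Segment.

Lemma segment_concat (f : R -> X) (cf : continuous f) (a b c : R) :
  path_homotopic (concat (segment cf a b) (segment cf b c)) (segment cf a c).
Proof.
pose v (s : I) : R := if of_unit s <= 2^-1 then (b - a) * (2 * of_unit s) + a
  else (c - b) * (2 * of_unit s - 1) + b.
apply: (@straight_homotopic (f \o fst) v (fun=> 0)
   (fun s => (c - a) * of_unit s + a) (fun=> 0)).
- by move=> r; apply: continuous_comp; [exact: cvg_fst|exact: cf].
- have c2 : continuous (fun s : I => 2 * of_unit s).
    by apply: continuous_scale; exact: continuous_of_unit.
  apply: continuous_glue; first exact: continuous_of_unit.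
  + exact: continuous_affine.
  + apply: continuous_affine => s.
    rewrite (_ : (fun _ => _) = fun s : I => 2 * of_unit s + -1) //.
    by apply: continuous_affine; exact: continuous_of_unit.
  + by move=> t ->; lra.
- exact: cst_continuous.
- by apply: continuous_affine; exact: continuous_of_unit.
- exact: cst_continuous.
- by congr pair; rewrite /v of_unit0; case: ifP; lra.
- by congr pair; rewrite /v of_unit1; case: ifP; lra.
- move=> s; have /andP[s0 s1] := of_unit_itv s.
  rewrite /= /mk_path /concat_fun /v /=; case: leP => sh.
    by rewrite /= /mk_path /segment_fun clampK //; lra.
  by rewrite /= /mk_path /segment_fun clampK //; lra.
- by [].
Qed.

End Paths.

(** * Holonomy classes and their local form *)

Section Holonomy.
Variables (R : realType) (X : topologicalType) (x : X).
Local Notation I := (unit_interval R).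
Local Notation pi1 := (fundamental_group R x).
Implicit Types y z : X.
Local Open Scope group_scope.

(** One path is fixed per end point, so that the closing paths of composable paths cancel. [None] is
    possible because connectedness does not give path-connectedness. *)
Definition base_path y : option {path I from x to y} :=
  if pselect (inhabited {path I from x to y}) is left h
  then Some (inhabited_witness h) else None.

Lemma base_pathN y : base_path y = None -> {path I from x to y} -> False.
Proof.
by rewrite /base_path; case: pselect => // nh _ p; apply: nh; exact: inhabits.
Qed.

(* Outside the path component of [x] the value is the junk value [1]. *)
Definition holonomy y z (p : {path I from y to z}) : pi1 :=
  if base_path y is Some t then
    if base_path z is Some u then \pi_pi1 (concat (concat t p) (reverse u))
    else 1
  else 1.

Lemma holonomy_homotopic y z (p q : {path I from y to z}) :
  path_homotopic p q -> holonomy p = holonomy q.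
Proof.
move=> pq; rewrite /holonomy; case: (base_path y) => // t.
case: (base_path z) => // u; apply/pi1P.
apply: concat_homotopic; last exact: path_homotopic_refl.
by apply: concat_homotopic => //; exact: path_homotopic_refl.
Qed.

(** Compares paths whose end points are equal only propositionally, such as segments of two
    functions. *)
Lemma holonomy_eq y z y' z' (p : {path I from y to z})
    (q : {path I from y' to z'}) : p =1 q -> holonomy p = holonomy q.
Proof.
move=> pq.
have yy' : y = y' by rewrite -(path_zero (s := p)) pq path_zero.
have zz' : z = z' by rewrite -(path_one (s := p)) pq path_one.
by subst y' z'; congr holonomy; apply/path_eqP.
Qed.

(** The fixed path to [z] is traversed back and forth in the middle. The junk values fit, since
    composable paths lie in one path component. *)
Lemma holonomy_concat y z w (p : {path I from y to z})
    (q : {path I from z to w}) :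
  holonomy (concat p q) = holonomy p * holonomy q.
Proof.
rewrite /holonomy.
case Ey: (base_path y) => [t|]; last first.
  case Ez: (base_path z) => [u|]; last by rewrite mul1g.
  by case: (base_pathN Ey (concat u (reverse p))).
case Ez: (base_path z) => [u|]; last by case: (base_pathN Ez (concat t p)).
case Ew: (base_path w) => [v|]; last by case: (base_pathN Ew (concat u q)).
rewrite [RHS]pi1_mulE; apply/pi1P/path_homotopic_sym.
have refl := @path_homotopic_refl R X.
apply: path_homotopic_trans.
  by apply: path_homotopic_sym; exact: concatA_homotopic.
apply: (path_homotopic_trans (q := concat (concat t p) (concat q (reverse v)))).
  apply: concat_homotopic => //.
  apply: path_homotopic_trans; first exact: concatA_homotopic.
  apply: concat_homotopic => //.
  apply: path_homotopic_trans; first exact: concatA_homotopic.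
  apply: (path_homotopic_trans (q := concat (const_path R z) q));
    last exact: concat1p_homotopic.
  by apply: concat_homotopic => //; exact: concatVp_homotopic.
apply: path_homotopic_trans; first exact: concatA_homotopic.
apply: concat_homotopic => //.
by apply: path_homotopic_sym; exact: concatA_homotopic.
Qed.

Lemma holonomy_const y : holonomy (const_path R y) = 1.
Proof.
apply: (@mulgI _ (holonomy (const_path R y))).
rewrite mulg1 -holonomy_concat; apply: holonomy_homotopic.
exact: concat1p_homotopic.
Qed.

(** Closing up a loop conjugates it by the fixed path from [x] to itself, which is invisible in the
    abelianisation. *)
Lemma holonomy_loop (p : {path I from x to x}) :
  \pi_(abelianization pi1) (holonomy p) = \pi_(abelianization pi1) (\pi_pi1 p).
Proof.
rewrite /holonomy; case E: (base_path x) => [t|]; last first.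
  by case: (base_pathN E (const_path R x)).
have -> : \pi_pi1 (concat (concat t p) (reverse t)) =
    \pi_pi1 t * \pi_pi1 p * (\pi_pi1 t)^-1.
  by rewrite [_^-1]pi1_invE [X in X * _]pi1_mulE [RHS]pi1_mulE.
move: (\pi_pi1 t) (\pi_pi1 p) => a b.
have abM := @ab_mulE pi1.
rewrite -!abM -/(_ * _) [ab_mul _ (\pi b)](abelianizationC) -[LHS]ab_mulA.
by rewrite !abM mulgV mulg1.
Qed.

(** The default [1] for discontinuous [f] keeps continuity proofs out of the terms. *)
Definition hol (f : R -> X) (a b : R) : pi1 :=
  if pselect (continuous f) is left cf then holonomy (segment cf a b) else 1.

Lemma holE f (cf : continuous f) a b : hol f a b = holonomy (segment cf a b).
Proof. by rewrite /hol; case: pselect => // cf'; exact: holonomy_eq. Qed.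

Lemma hol_concat f a b c : continuous f ->
  hol f a b * hol f b c = hol f a c.
Proof.
move=> cf; rewrite !(holE cf) -holonomy_concat.
by apply: holonomy_homotopic; exact: segment_concat.
Qed.

Lemma hol_eq f g (a b : R) : continuous f -> continuous g -> (a <= b)%R ->
  (forall t, a <= t -> t <= b -> f t = g t)%R -> hol f a b = hol g a b.
Proof.
move=> cf cg ab fg; rewrite (holE cf) (holE cg); apply: holonomy_eq => s.
have /andP[s0 s1] := of_unit_itv s.
have ? : (0 <= (b - a) * of_unit s)%R by apply: mulr_ge0 => //; lra.
have ? : (0 <= (b - a) * (1 - of_unit s))%R by apply: mulr_ge0; lra.
by rewrite /= /mk_path /segment_fun fg //; lra.
Qed.

Lemma hol_loop (p : {path I from x to x}) :
  hol (fun r => p (clamp r)) 0%R 1%R = holonomy p.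
Proof.
have cp : continuous (fun r : R => p (clamp r)).
  by move=> r; apply: continuous_comp; [exact: continuous_clamp|exact: cts_fun].
rewrite (holE cp); apply: holonomy_eq => s.
by rewrite /= /mk_path /segment_fun subr0 mul1r addr0 of_unitK.
Qed.

(* Loops are only required to be trivial when based at [y] itself, hence the
   restriction to paths issued from [y]. *)
Lemma holonomy_local y (slscX : semilocally_1_connected R X) :
  exists2 U, nbhs y U & exists g : X -> pi1,
    forall z (p : {path I from y to z}), (forall t, U (p t)) ->
      holonomy p = g z.
Proof.
have [U yU UP] := slscX y; exists U => //.
have /choice[g gP] : forall z, exists h : pi1,
    forall p : {path I from y to z}, (forall t, U (p t)) -> holonomy p = h.
  move=> z; have [[p Up]|nP] := pselect
      (exists p : {path I from y to z}, forall t, U (p t)); last first.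
    by exists 1 => p Up; case: nP; exists p.
  exists (holonomy p) => q Uq.
  (* [q] followed by [p] backwards is a loop at [y] inside [U], hence null-homotopic. *)
  have pq : holonomy (concat q (reverse p)) = 1.
    rewrite -(holonomy_const y); apply/holonomy_homotopic/UP => t.
    by rewrite /= /mk_path /concat_fun; case: ifP => _ //; exact: Up.
  have pp : holonomy (concat (reverse p) p) = 1.
    rewrite -(holonomy_const z); apply: holonomy_homotopic.
    exact: concatVp_homotopic.
  rewrite -[LHS]mulg1 -pp holonomy_concat mulgA -holonomy_concat pq.
  by rewrite mul1g.
by exists g.
Qed.

Lemma hol_local y (slscX : semilocally_1_connected R X) :
  exists2 U, (open U /\ U y) & exists g : X -> pi1,
    forall f (a b : R), continuous f -> (a <= b)%R -> f a = y ->
      (forall t, a <= t -> t <= b -> U (f t))%R -> hol f a b = g (f b).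
Proof.
have [U yU [g gP]] := holonomy_local y slscX.
exists U°.
  by split; [exact: open_interior|exact: nbhs_singleton (nbhs_interior yU)].
exists g => f a b cf ab fa fU; subst y.
rewrite (holE cf); apply: gP => s; have /andP[s0 s1] := of_unit_itv s.
have ? : (0 <= (b - a) * of_unit s)%R by apply: mulr_ge0 => //; lra.
have ? : (0 <= (b - a) * (1 - of_unit s))%R by apply: mulr_ge0; lra.
rewrite /= /mk_path /segment_fun; apply: interior_subset.
by apply: fU; lra.
Qed.

(** Near each parameter the values lie in one of two disjoint open sets, so membership in [U] is
    locally constant along [f]. *)
Lemma stay_open (U V : set X) (f : R -> X) (a b : R) :
  open U -> open V -> U `&` V `<=` set0 -> continuous f -> (a <= b)%R ->
  (forall t, a <= t -> t <= b -> (U `|` V) (f t))%R -> U (f a) ->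
  (forall t, a <= t -> t <= b -> U (f t))%R.
Proof.
move=> oU oV UV cf ab fUV Ua t at_ tb.
suff : U (f a) <-> U (f t) by case=> + _; apply.
apply: (chain_ind (P := fun u v => U (f u) <-> U (f v))) => //.
  by move=> u v w _ _ _ _ -> ->.
move=> u au ut; have ub := le_trans ut tb.
have nW (W : set X) : open W -> W (f u) -> \forall v \near u, W (f v).
  by move=> oW Wu; apply: (cf u); exact: open_nbhs_nbhs.
have [/(nW U oU)/near_dist[e e0 eW]|/(nW V oV)/near_dist[e e0 eW]] :=
  fUV u au ub.
  by exists e => // v w _ _ _ uv uw; split=> _; exact: eW.
exists e => // v w _ _ _ uv uw.
by split=> h; [case: (UV (f v)); split=> //|case: (UV (f w)); split=> //];
  exact: eW.
Qed.

(** A coordinate of a lift may start at either coordinate of a given orbit, so one neighbourhood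
    must serve both points. If they differ, [O] is a disjoint union, and the piece containing the
    end of a path tells where it started. *)
Lemma hol_local2 y z (slscX : semilocally_1_connected R X)
    (hausX : hausdorff_space X) :
  exists2 O, [/\ open O, O y & O z] & exists g : X -> pi1,
    forall f (a b : R), continuous f -> (a <= b)%R -> f a = y \/ f a = z ->
      (forall t, a <= t -> t <= b -> O (f t))%R -> hol f a b = g (f b).
Proof.
have [U [oU Uy] [g gP]] := hol_local y slscX.
have [yz|/eqP yz] := eqVneq y z.
  exists U; first by rewrite -yz.
  by exists g => f a b cf ab fa; apply: gP => //; case: fa => ->.
have [V [oV Vz] [k kP]] := hol_local z slscX.
move/eqP: yz => yz; move: hausX; rewrite open_hausdorff => /(_ _ _ yz).
move=> [[A B] /= [/set_mem Ay /set_mem Bz] [oA oB /eqP AB0]].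
have UV0 : (U `&` A) `&` (V `&` B) `<=` set0.
  by move=> w [[_ Aw] [_ Bw]]; rewrite -AB0.
have oUA : open (U `&` A) by exact: openI.
have oVB : open (V `&` B) by exact: openI.
exists ((U `&` A) `|` (V `&` B)).
  by split; [exact: openU|left|right].
exists (fun w => if `[< (U `&` A) w >] then g w else k w).
move=> f a b cf ab fa fO; case: asboolP => [Ub|nUb].
  have Ua : (U `&` A) (f a).
    have [//|Va] := fO a (lexx a) ab.
    have : (V `&` B) (f b).
      apply: (stay_open oVB oUA _ cf ab _ Va ab (lexx b)).
        by rewrite setIC.
      by rewrite setUC.
    by move=> Vb; case: (UV0 (f b)).
  have [//|fz] := fa; last first.
    by case: (UV0 z); split; [rewrite -fz|].
  move=> fy; apply: gP => // t at_ tb.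
  by case: (stay_open oUA oVB UV0 cf ab fO Ua at_ tb).
have Va : (V `&` B) (f a).
  have [Ua|//] := fO a (lexx a) ab.
  by case: nUb; exact: (stay_open oUA oVB UV0 cf ab fO Ua ab (lexx b)).
have [fy|fz] := fa.
  by case: (UV0 y); split; [|rewrite -fy].
apply: kP => // t at_ tb.
have := stay_open oVB oUA _ cf ab _ Va at_ tb.
by rewrite setIC setUC => /(_ UV0 fO)[].
Qed.

End Holonomy.

(** * Holonomy of lifts of a homotopy *)

Lemma continuous_pair (T A B : topologicalType) (u : T -> A) (v : T -> B) :
  continuous u -> continuous v -> continuous (fun t => (u t, v t)).
Proof. by apply: (@continuous_pair_comp _ _ _ _ id) => p; exact: cvg_id. Qed.

Section LiftHolonomy.
Variables (R : realType) (X : topologicalType) (x : X).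
Hypothesis hausX : hausdorff_space X.
Hypothesis slscX : semilocally_1_connected R X.
Local Notation pi1 := (fundamental_group R x).
Local Notation A := (abelianization pi1).
Local Open Scope group_scope.

(** Multiplying in the abelianisation makes the value insensitive to exchanging the coordinates. *)
Definition lift_hol (f : R -> X * X) (a b : R) : A :=
  \pi_A (hol x (fst \o f) a b) * \pi_A (hol x (snd \o f) a b).

Lemma continuous_fst_comp (f : R -> X * X) :
  continuous f -> continuous (fst \o f).
Proof. by move=> cf t; apply: continuous_comp; [exact: cf|exact: cvg_fst]. Qed.

Lemma continuous_snd_comp (f : R -> X * X) :
  continuous f -> continuous (snd \o f).
Proof. by move=> cf t; apply: continuous_comp; [exact: cf|exact: cvg_snd]. Qed.

Lemma lift_hol_concat f a b c : continuous f ->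
  lift_hol f a b * lift_hol f b c = lift_hol f a c.
Proof.
move=> cf; rewrite /lift_hol.
rewrite -(hol_concat x a b c (continuous_fst_comp cf)).
rewrite -(hol_concat x a b c (continuous_snd_comp cf)).
rewrite -[\pi_A (_ * _)]ab_mulE -[X in _ = _ * X]ab_mulE -!/(_ * _).
rewrite -!mulgA; congr (_ * _); rewrite !mulgA; congr (_ * _).
exact: abelianizationC.
Qed.

Lemma lift_hol_eq f g (a b : R) : continuous f -> continuous g -> (a <= b)%R ->
  (forall t, a <= t -> t <= b -> f t = g t)%R ->
  lift_hol f a b = lift_hol g a b.
Proof.
move=> cf cg ab fg; rewrite /lift_hol; congr (\pi_A _ * \pi_A _).
  apply: hol_eq ab _; [exact: continuous_fst_comp..|].
  by move=> t ? ? /=; rewrite fg.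
apply: hol_eq ab _; [exact: continuous_snd_comp..|].
by move=> t ? ? /=; rewrite fg.
Qed.

Lemma lift_hol_cst u a b : lift_hol (cst u) a b = 1.
Proof.
suff h (y : X) (k : R -> X) : k = cst y -> hol x k a b = 1.
  by rewrite /lift_hol (h u.1) // (h u.2) // [LHS]ab_mulE mulg1.
move=> ->; rewrite (holE x (@cst_continuous R X y)) -(holonomy_const R x y).
exact: holonomy_eq.
Qed.

(** [G] records the holonomy of small lifts issued from the fibre over [H q], as a function of their
    end in the symmetric square; other small lifts are differences of two such. *)
Lemma lift_hol_local (H : R * R -> symmetric_square X) (q : R * R) :
  continuous H -> exists2 e : R, (0 < e)%R & exists G : symmetric_square X -> A,
    forall (c : R -> R * R) (f : R -> X * X) (a b : R),
      continuous f -> (a <= b)%R ->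
      (forall t, a <= t -> t <= b ->
         `|q.1 - (c t).1| < e /\ `|q.2 - (c t).2| < e)%R ->
      (forall t, sq (f t) = H (c t)) ->
      lift_hol f a b = (G (H (c a)))^-1 * G (H (c b)).
Proof.
move=> cH; have [u uq] := sq_surj (H q).
have [O [oO Ou1 Ou2] [g gP]] := hol_local2 x u.1 u.2 slscX hausX.
pose OO : set (X * X) := fst @^-1` O `&` snd @^-1` O.
have oOO : open OO.
  by apply: openI; apply: open_comp => // v _; [exact: cvg_fst|exact: cvg_snd].
(* [OO] is invariant under [swap], so every lift of a path in its image stays in it. *)
have OOE v : (sq @` OO) (sq v) -> OO v.
  by move=> [w [w1 w2] /sqE[->|->]].
have : nbhs q (H @^-1` (sq @` OO)).
  apply: cH; apply: (@open_nbhs_nbhs (symmetric_square X)); split.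
    exact: open_sq.
  by rewrite -uq; exists u.
move=> /nbhs_ballP[e /= e0 eO]; exists e => //.
pose G (k : symmetric_square X) : A :=
  \pi_A (g (repr k).1) * \pi_A (g (repr k).2).
(* Commutativity makes [G] independent of the order of coordinates picked by [repr]. *)
have GE v : G (sq v) = \pi_A (g v.1) * \pi_A (g v.2).
  have : sq (repr (sq v)) = sq v by rewrite /sq reprK.
  by rewrite /G => /sqE[] vE; rewrite [in RHS]vE //=; exact: abelianizationC.
exists G.
have base f a b : continuous f -> (a <= b)%R -> sq (f a) = H q ->
    (forall t, a <= t -> t <= b -> (sq @` OO) (sq (f t)))%R ->
    lift_hol f a b = G (sq (f b)).
  move=> cf ab fa fO; rewrite GE /lift_hol.
  have fu : f a = u \/ f a = swap u.
    by apply/sqE; rewrite fa.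
  congr (\pi_A _ * \pi_A _); apply: gP => //.
  - exact: continuous_fst_comp.
  - by case: fu => /= ->; [left|right].
  - by move=> t at_ tb; case: (OOE _ (fO t at_ tb)).
  - exact: continuous_snd_comp.
  - by case: fu => /= ->; [right|left].
  - by move=> t at_ tb; case: (OOE _ (fO t at_ tb)).
move=> c f a b cf ab cq fc.
(* The functions [g] only measure paths issued from [q], so [f] is prolonged
   backwards by a lift of the segment from [q] to [c a]. *)
pose r t : R * R := (((c a).1 - q.1) * (t - (a - 1)) + q.1,
                     ((c a).2 - q.2) * (t - (a - 1)) + q.2)%R.
have cr : continuous r.
  have ct : continuous (fun t : R => t - (a - 1))%R.
    move=> t; apply: (@continuousD R R R id (cst (- (a - 1)))%R).
      exact: cvg_id.
    exact: cst_continuous.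
  by apply: continuous_pair; exact: (continuous_affine ct).
have ra : r a = c a.
  by rewrite [RHS]surjective_pairing /r; congr pair; lra.
have rq : r (a - 1)%R = q.
  by rewrite [RHS]surjective_pairing /r; congr pair; lra.
have rO t : (a - 1 <= t)%R -> (t <= a)%R -> (sq @` OO) (H (r t)).
  move=> at_ ta; apply: eO.
  have [q1 q2] := cq a (lexx a) ab.
  have conv (k l : R) :
      (`|k - l| < e -> `|k - ((l - k) * (t - (a - 1)) + k)| < e)%R.
    move=> kl; rewrite opprD addrCA subrr addr0 normrN normrM.
    rewrite distrC; apply: le_lt_trans kl.
    by rewrite ler_piMr // ger0_norm; lra.
  by split; rewrite /ball /=; exact: conv.
have [h0 ch0 h0r] : exists2 h, continuous h & forall t, sq (h t) = H (r t).
  apply: sq_lift => // t; apply: continuous_comp; [exact: cr|exact: cH].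
(* The lift of the segment is swapped if necessary, so that it ends at [f a] and can be glued to
   [f]. *)
have [h ch [hr ha]] : exists2 h, continuous h &
    (forall t, sq (h t) = H (r t)) /\ h a = f a.
  have : sq (h0 a) = sq (f a) by rewrite h0r ra fc.
  move=> /sqE[->|->]; first by exists h0.
  exists (@swap X \o h0).
    by move=> t; apply: continuous_comp; [exact: ch0|exact: swap_continuous].
  by split=> // t; rewrite /= sq_swap.
pose k t := if (t <= a)%R then h t else f t.
have ck : continuous k.
  by apply: (continuous_glue (h := id)) => // [t|t ->]; first exact: cvg_id.
have kh t : (t <= a)%R -> k t = h t by rewrite /k => ->.
have kf t : (a <= t)%R -> k t = f t.
  rewrite /k; case: (ltgtP t a) => // -> _; exact: ha.
have a1a : (a - 1 <= a)%R by lra.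
have k0 : sq (k (a - 1)%R) = H q by rewrite kh // hr rq.
have e1 : lift_hol k (a - 1)%R a = G (H (c a)).
  rewrite -ra -hr -kh //; apply: base => // t at_ ta.
  by rewrite kh // hr; exact: rO.
have e2 : lift_hol k (a - 1)%R b = G (H (c b)).
  rewrite -fc -kf //; apply: base => //; first lra.
  move=> t at_ tb; have [ta|/ltW ta] := leP t a.
    by rewrite kh // hr; exact: rO.
  rewrite kf // fc; apply: eO.
  by have [? ?] := cq t ta tb; split.
rewrite -e1 -e2 -(lift_hol_concat (a - 1)%R a b ck) mulgA mulVg mul1g.
by apply: lift_hol_eq => // t at_ tb; rewrite kf.
Qed.

Lemma lift_hol_homotopy (H : R * R -> symmetric_square X)
    (f f' : R -> X * X) :
  continuous H ->
  (forall s, H (0%R, s) = diag_class x) ->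
  (forall s, H (1%R, s) = diag_class x) ->
  continuous f -> continuous f' ->
  (forall t, sq (f t) = H (t, 0%R)) -> (forall t, sq (f' t) = H (t, 1%R)) ->
  lift_hol f 0%R 1%R = lift_hol f' 0%R 1%R.
Proof.
move=> cH H0 H1 cf cf' fH f'H.
pose lift (c : R -> R * R) f := continuous f /\ forall t, sq (f t) = H (c t).
pose hor (s t : R) : R * R := (t, s).
pose ver (t s : R) : R * R := (t, s).
have ex c : continuous c -> exists f, lift c f.
  move=> cc; have [|h ch hH] := sq_lift hausX (d := H \o c).
    by move=> t; apply: continuous_comp; [exact: cc|exact: cH].
  by exists h.
have chor s : continuous (hor s).
  by apply: continuous_pair => t; [exact: cvg_id|exact: cst_continuous].
have cver t : continuous (ver t).
  by apply: continuous_pair => s; [exact: cst_continuous|exact: cvg_id].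
suff : forall f f', lift (hor 0%R) f -> lift (hor 1%R) f' ->
    lift_hol f 0%R 1%R = lift_hol f' 0%R 1%R by apply.
move=> {f f' cf cf' fH f'H}.
(* Outer induction on the deformation parameter: quantifying over all lifts lets any lift of an
   intermediate row serve both neighbouring strips. *)
apply: (chain_ind (P := fun s s' => forall f f',
    lift (hor s) f -> lift (hor s') f' ->
    lift_hol f 0%R 1%R = lift_hol f' 0%R 1%R)).
- exact: ler01.
- move=> s s' s'' _ _ _ _ ss' s's'' f f'' lf lf''.
  have [f' lf'] := ex _ (chor s').
  by rewrite (ss' _ _ lf lf'); exact: s's''.
move=> s0 _ _.
(* Inner induction along the paths: for thin rectangles around height [s0], the bottom and right
   sides have together the holonomy of the left and top sides. *)
pose square t t' := exists2 e : R, (0 < e)%R & forall s s' f f' v v',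
  (s <= s')%R -> (`|s0 - s| < e)%R -> (`|s0 - s'| < e)%R ->
  lift (hor s) f -> lift (hor s') f' -> lift (ver t) v -> lift (ver t') v' ->
  lift_hol f t t' * lift_hol v' s s' = lift_hol v s s' * lift_hol f' t t'.
(* The outer vertical sides lie over [diag_class x], so they have constant lifts, which contribute
   [1]. *)
have [] : square 0%R 1%R; last first.
  move=> e e0 eP; exists e => // s s' _ ss' _ ds ds' f f' lf lf'.
  have lx t : (forall s, H (t, s) = diag_class x) -> lift (ver t) (cst (x, x)).
    by move=> Ht; split=> [|r]; [exact: cst_continuous|rewrite /ver Ht].
  have := eP s s' f f' _ _ ss' ds ds' lf lf' (lx _ H0) (lx _ H1).
  by rewrite !lift_hol_cst mulg1 mul1g.
apply: chain_ind.
- exact: ler01.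
- move=> t t' t'' _ _ _ _ [e e0 eP] [e' e'0 e'P].
  exists (Num.min e e'); first by rewrite lt_min e0.
  move=> s s' f f' v v'' ss'; rewrite !lt_min => /andP[se se'] /andP[s'e s'e'].
  (* Adjacent rectangles share the side at [t']; one lift [v'] of it is used for both. *)
  move=> lf lf' lv lv''; have [v' lv'] := ex _ (cver t').
  rewrite -(lift_hol_concat t t' t'' lf.1) -(lift_hol_concat t t' t'' lf'.1).
  have e1 := eP s s' f f' v v' ss' se s'e lf lf' lv lv'.
  have e2 := e'P s s' f f' v' v'' ss' se' s'e' lf lf' lv' lv''.
  by rewrite -mulgA e2 mulgA e1; exact/esym/mulgA.
- move=> t0 _ _; have [e e0 [G GP]] := lift_hol_local (t0, s0) cH.
  exists e => // t t' _ tt' _ dt dt'; exists e => // s s' f f' v v' ss' ds ds'.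
  move=> [cf fH] [cf' f'H] [cv vH] [cv' v'H].
  have b1 r : (t <= r)%R -> (r <= t')%R -> (`|t0 - r| < e)%R.
    by move=> tr rt; apply: (between_ball dt dt'); rewrite /between tr rt.
  have b2 r : (s <= r)%R -> (r <= s')%R -> (`|s0 - r| < e)%R.
    by move=> sr rs; apply: (between_ball ds ds'); rewrite /between sr rs.
  rewrite (GP (hor s) f) // => [|r tr rt]; last by split=> //; exact: b1.
  rewrite (GP (hor s') f') // => [|r tr rt]; last by split=> //; exact: b1.
  rewrite (GP (ver t) v) // => [|r sr rs]; last by split=> //; exact: b2.
  rewrite (GP (ver t') v') // => [|r sr rs]; last by split=> //; exact: b2.
  (* Both ways around the rectangle give the increment of [G] between opposite corners. *)
  by rewrite /hor /ver -!mulgA !mulVKg.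
Qed.

End LiftHolonomy.

(** * The comparison homomorphism *)

Section SymmetricSquarePi1.
Variables (R : realType) (X : topologicalType) (x : X).
Local Notation I := (unit_interval R).
Local Notation loop := {path I from x to x}.
Local Notation pi1 := (fundamental_group R x).
Local Notation pi1Q := (fundamental_group R (diag_class x)).
Local Open Scope group_scope.

Section LoopPair.
Variables p q : loop.

Definition loop_pair_fun (t : I) : symmetric_square X := sq (p t, q t).

Lemma loop_pair_continuous : continuous loop_pair_fun.
Proof.
move=> t; apply: (continuous_comp (f := fun t => (p t, q t))).
  by apply: continuous_pair; exact: cts_fun.
exact: sq_continuous.
Qed.

Lemma loop_pair_zero : loop_pair_fun zero = diag_class x.
Proof. by rewrite /loop_pair_fun !path_zero. Qed.

Lemma loop_pair_one : loop_pair_fun one = diag_class x.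
Proof. by rewrite /loop_pair_fun !path_one. Qed.

Definition loop_pair : {path I from diag_class x to diag_class x} :=
  mk_path loop_pair_continuous loop_pair_zero loop_pair_one.

End LoopPair.

Lemma loop_pairC p q : loop_pair p q = loop_pair q p.
Proof. by apply/path_eqP => t; exact: (sq_swap (q t, p t)). Qed.

Definition pi1_sq (a : pi1) : pi1Q :=
  \pi_pi1Q (loop_pair (repr a) (const_path R x)).

Lemma pi1_sqE p :
  pi1_sq (\pi_pi1 p) = \pi_pi1Q (loop_pair p (const_path R x)).
Proof.
apply/pi1P; have [H [cH H0 H1 Hx Hy]] := pi1_repr p.
exists (fun st => sq (H st, x)); split => [|s|s|t|t].
- move=> st; apply: (continuous_comp (f := fun st => (H st, x))).
    by apply: continuous_pair => //; exact: cst_continuous.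
  exact: sq_continuous.
- by rewrite H0.
- by rewrite H1.
- by rewrite Hx.
- by rewrite Hy.
Qed.

Lemma pi1_sqM : {morph pi1_sq : a b / a * b}.
Proof.
elim/quotW => p; elim/quotW => q.
rewrite [X in pi1_sq X]pi1_mulE !pi1_sqE.
rewrite [RHS]pi1_mulE; congr (\pi_pi1Q _); apply/path_eqP => t.
rewrite /= /mk_path /loop_pair_fun /= /mk_path /concat_fun.
by case: ifP.
Qed.

(** The product runs along two sides of the unit square of parameters of [(p, q)], and
    [loop_pair p q] along its diagonal. On the second side the symmetry identifies [(q, x)] with
    [(x, q)]. *)
Lemma pi1_sq_pair p q :
  pi1_sq (\pi_pi1 p) * pi1_sq (\pi_pi1 q) = \pi_pi1Q (loop_pair p q).
Proof.
rewrite !pi1_sqE [LHS]pi1_mulE; apply/pi1P.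
have cp (r : loop) : continuous (fun t : R => r (clamp t)).
  by move=> t; apply: continuous_comp; [exact: continuous_clamp|exact: cts_fun].
have cclamp (w : I -> R) : continuous w ->
    continuous (fun s => of_unit (clamp (w s))).
  move=> cw s.
  apply: (@continuous_comp _ _ _ (fun s => clamp (w s)) (@of_unit R)).
    exact: continuous_clamp_comp.
  exact: continuous_of_unit.
have clamp_ge1 (t : R) : (1 <= t)%R -> clamp t = one.
  move=> t1; apply: of_unit_inj; rewrite of_unit1.
  by rewrite /of_unit set_valE /= min_r // max_r.
have clamp_le0 (t : R) : (t <= 0)%R -> clamp t = zero.
  move=> t0; apply: of_unit_inj; rewrite of_unit0 /of_unit set_valE /=.
  by apply: max_l; rewrite ge_min t0.
have c2 : continuous (fun s : I => 2 * of_unit s)%R.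
  by apply: continuous_scale; exact: continuous_of_unit.
apply: (straight_homotopic
    (F := fun ab : R * R => sq (p (clamp ab.1), q (clamp ab.2)))
    (u1 := fun s => of_unit (clamp (2 * of_unit s)%R))
    (u2 := fun s => of_unit (clamp (2 * of_unit s + -1)%R))
    (v1 := @of_unit R) (v2 := @of_unit R)).
- move=> ab; apply: (continuous_comp
    (f := fun ab : R * R => (p (clamp ab.1), q (clamp ab.2)))).
    apply: continuous_pair => {}ab.
      apply: (@continuous_comp _ _ _ fst (fun t : R => p (clamp t))).
        exact: cvg_fst.
      exact: cp.
    apply: (@continuous_comp _ _ _ snd (fun t : R => q (clamp t))).
      exact: cvg_snd.
    exact: cp.
  exact: sq_continuous.
- exact: cclamp.
- by apply: cclamp; apply: continuous_affine; exact: continuous_of_unit.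
- exact: continuous_of_unit.
- exact: continuous_of_unit.
- by rewrite of_unit0 clamp_le0 ?clamp_le0 ?of_unit0 //; lra.
- by rewrite of_unit1 clamp_ge1 ?clamp_ge1 ?of_unit1 //; lra.
- move=> s; have /andP[s0 s1] := of_unit_itv s.
  rewrite /= !of_unitK /mk_path /concat_fun; case: leP => sh.
    rewrite /= /mk_path /loop_pair_fun /=; congr (sq (_, _)).
    by rewrite (clamp_le0 (2 * of_unit s + -1)%R) ?path_zero //; lra.
  rewrite /= /mk_path /loop_pair_fun /= (clamp_ge1 (2 * of_unit s)%R); last lra.
  by rewrite [p one]path_one -[LHS]sq_swap.
- by move=> s; rewrite /= of_unitK.
Qed.

(** * Factorisation through the abelianisation, surjectivity and injectivity *)

Lemma pi1_sqC a b : pi1_sq a * pi1_sq b = pi1_sq b * pi1_sq a.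
Proof.
elim/quotW: a => p; elim/quotW: b => q.
by rewrite !pi1_sq_pair loop_pairC.
Qed.

Lemma pi1_sq1 : pi1_sq 1 = 1.
Proof. by apply: (@mulgI _ (pi1_sq 1)); rewrite -pi1_sqM !mulg1. Qed.

Lemma pi1_sqV a : pi1_sq a^-1 = (pi1_sq a)^-1.
Proof.
by apply: (@mulgI _ (pi1_sq a)); rewrite -pi1_sqM !mulgV pi1_sq1.
Qed.

(** The kernel is a subgroup, and it contains the commutators because values of [pi1_sq] commute. *)
Lemma pi1_sq_commutator a : commutator_subgroup a -> pi1_sq a = 1.
Proof.
move=> Da; suff : [set b | pi1_sq b = 1] a by [].
apply: Da; split; last first.
  move=> _ [b _ [c _ <-]] /=; rewrite /commg /conjg !pi1_sqM !pi1_sqV.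
  by rewrite (pi1_sqC b c) mulKg mulVg.
split; first by apply/mem_set; exact: pi1_sq1.
move=> b c /set_mem /= b1 /set_mem /= c1; apply/mem_set => /=.
by rewrite pi1_sqM pi1_sqV b1 c1 mulgV.
Qed.

Lemma pi1_sq_eq a b :
  \pi_(abelianization pi1) a = \pi_(abelianization pi1) b ->
  pi1_sq a = pi1_sq b.
Proof.
move=> /abP /pi1_sq_commutator; rewrite pi1_sqM pi1_sqV => ab1.
by apply: (@mulgI _ (pi1_sq a)^-1); rewrite mulVg ab1.
Qed.

(** The orbit of [(x, x)] is a single point, so a lift of a loop is a pair of loops [p], [q] at [x],
    and [pi1_sq_pair] applies. Loops are extended to the line by [clamp] before lifting. *)
Lemma pi1_sq_surj : hausdorff_space X -> forall c, exists a, pi1_sq a = c.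
Proof.
move=> hausX; elim/quotW => d.
have [|f cf fd] := sq_lift hausX (d := fun t : R => d (clamp t)).
  by move=> t; apply: continuous_comp; [exact: continuous_clamp|exact: cts_fun].
have fx (t : R) : d (clamp t) = diag_class x -> f t = (x, x).
  by rewrite -fd => /sqE[-> //|h]; rewrite -[f t]swapK -h.
have f0 : f (of_unit zero) = (x, x).
  by apply: fx; rewrite of_unitK path_zero.
have f1 : f (of_unit one) = (x, x).
  by apply: fx; rewrite of_unitK path_one.
have cI (k : R -> X) : continuous k -> continuous (k \o @of_unit R).
  move=> ck t; apply: continuous_comp; last exact: ck.
  exact: continuous_of_unit.
have [p pE] : exists p : loop, forall t, p t = (f (of_unit t)).1.
  have p0 : ((fst \o f) \o @of_unit R) zero = x by rewrite /= f0.
  have p1 : ((fst \o f) \o @of_unit R) one = x by rewrite /= f1.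
  by exists (mk_path (cI _ (continuous_fst_comp cf)) p0 p1).
have [q qE] : exists q : loop, forall t, q t = (f (of_unit t)).2.
  have p0 : ((snd \o f) \o @of_unit R) zero = x by rewrite /= f0.
  have p1 : ((snd \o f) \o @of_unit R) one = x by rewrite /= f1.
  by exists (mk_path (cI _ (continuous_snd_comp cf)) p0 p1).
exists (\pi_pi1 p * \pi_pi1 q); rewrite pi1_sqM pi1_sq_pair.
congr (\pi_pi1Q _); apply/path_eqP => t.
by rewrite /= /mk_path /loop_pair_fun pE qE -surjective_pairing fd of_unitK.
Qed.

Lemma pi1_sq_inj (hausX : hausdorff_space X)
    (slscX : semilocally_1_connected R X) a b :
  pi1_sq a = pi1_sq b ->
  \pi_(abelianization pi1) a = \pi_(abelianization pi1) b.
Proof.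
elim/quotW: a => p; elim/quotW: b => q; rewrite !pi1_sqE.
move/pi1P => [K [cK K0 K1 Kx Ky]].
pose H (ts : R * R) := K (clamp ts.1, clamp ts.2).
have cH : continuous H.
  apply: continuous_pair_comp => //.
    by apply: continuous_clamp_comp => ts; exact: cvg_fst.
  by apply: continuous_clamp_comp => ts; exact: cvg_snd.
have cp (r : loop) : continuous (fun t : R => r (clamp t)).
  by move=> t; apply: continuous_comp; [exact: continuous_clamp|exact: cts_fun].
(* The two ends of the homotopy have explicit lifts, and the holonomy of such a lift is the class of
   the loop [r]. *)
pose lift (r : loop) (t : R) := (r (clamp t), x).
have clift r : continuous (lift r).
  by apply: continuous_pair; [exact: cp|exact: cst_continuous].
have liftE r : lift_hol x (lift r) 0%R 1%R =
    \pi_(abelianization pi1) (\pi_pi1 r).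
  rewrite -holonomy_loop -hol_loop /lift_hol.
  have -> : hol x (snd \o lift r) 0%R 1%R = 1.
    rewrite (holE x (@cst_continuous R X x)) -(holonomy_const R x x).
    exact: holonomy_eq.
  by rewrite [LHS]ab_mulE mulg1.
rewrite -!liftE; apply: (lift_hol_homotopy hausX slscX cH) => //.
- by move=> s; rewrite /H -[RHS](Kx (clamp s)).
- by move=> s; rewrite /H -[RHS](Ky (clamp s)).
- by move=> t; rewrite /H -[clamp 0]/zero K0.
- by move=> t; rewrite /H -[clamp 1]/one K1.
Qed.

End SymmetricSquarePi1.

Theorem proposition2p12 (R : realType) (X : topologicalType)
    (connX : connected [set: X])
    (hausX : hausdorff_space X)
    (slscX : semilocally_1_connected R X)
    (x : X) :
  group_isomorphic
    (fundamental_group R (diag_class x))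
    (abelianization (fundamental_group R x)).
Proof.
set pi1 := fundamental_group R x; set pi1Q := fundamental_group R _.
have /choice[s sK] : forall c : pi1Q, exists a : pi1, pi1_sq a = c.
  exact: pi1_sq_surj.
(* This is the inverse of the map induced by [pi1_sq]. By injectivity, the preimage chosen by [s]
   does not matter modulo commutators, which makes [f] multiplicative. *)
pose f (c : pi1Q) : abelianization pi1 := \pi_(abelianization pi1) (s c).
have fM : {morph f : c d / (c * d)%g}.
  move=> c d; rewrite /f [RHS]ab_mulE; apply: pi1_sq_inj => //.
  by rewrite sK pi1_sqM !sK.
pose fm := isMultiplicative.Build _ _ f fM.
pose F : {multiplicative pi1Q -> abelianization pi1} := HB.pack f fm.
exists F; exists (fun u => pi1_sq (repr u)) => [c|].
  by rewrite -[RHS]sK; apply: pi1_sq_eq; rewrite reprK.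
elim/quotW => a /=; apply: pi1_sq_inj => //; rewrite sK.
by apply: pi1_sq_eq; rewrite reprK.
Qed.
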